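(* For a constant $c\in\mathbb{R}$ put $$A_c(t)=\begin{pmatrix} e^{ct}&0&0&e^{-ct}\\ 0&e^{-ct}&e^{ct}&0\end{pmatrix}.$$ (i) Let $D\subset\mathbb{R}^2$ be a domain and let $f_1,f_2$ be smooth functions of one variable such that $f_1(z_1),f_2(z_2)$ are defined and $1-f_1'(z_1)f_2'(z_2)\neq0$ for $(z_1,z_2)\in D$. Then $\varphi(z,t)=A_c(t)\,\big(z_1,z_2,f_1(z_1),f_2(z_2)\big)$ gives a solution to the two-dimensional incompressible Euler equations, with $$\det(d\varphi)=1-f_1'f_2'\qquad\text{and}\qquad \zeta=-\frac{2c\,(f_1'+f_2')}{1-f_1'f_2'}.$$ (ii) This is the most general solution $\varphi=Av$ with $v$ satisfying $g_{13}=g_{24}=0$, in the following sense. Let $D\subset\mathbb{R}^2$ be a domain, $I\subset\mathbb{R}$ an open interval, $A:I\to\mathbb{R}^{2\times4}$ and $v:D\to\mathbb{R}^4$ smooth, and suppose that $\varphi(z,t)=A(t)v(z)$ has $\det(d\varphi)\ne0$ everywhere and gives a solution to the Euler equations. Suppose that the constraints of $v$ are exactly $g_{13}=g_{24}=0$ and their linear combinations, and that the four columns of $A$ are linearly independent over $\mathbb{R}$ as functions of $t$. Then for every $z_0\in D$ there are a diffeomorphism $\psi$ from an open set $\hat U\subset\mathbb{R}^2$ onto a neighbourhood of $z_0$, a constant $c$, smooth functions $f_1,f_2$ of one variable with $1-f_1'f_2'\ne0$, and constants $c_0,c_1$ such that, with $S(t)=M(c_1t+c_0)$ or $S(t)=\hat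 M(c_1t+c_0)$, $$\varphi(\psi(z),t)=S(t)A_c(t)\,\big(z_1,z_2,f_1(z_1),f_2(z_2)\big),\qquad z\in\hat U,\ t\in I.$$
   Context: $M(\theta)=\begin{pmatrix}\cos\theta&-\sin\theta\\ \sin\theta&\cos\theta\end{pmatrix}$, $\hat M(\theta)=\begin{pmatrix}\cos\theta&\sin\theta\\ \sin\theta&-\cos\theta\end{pmatrix}$. For $v=(v^1,\dots,v^4):D\to\mathbb{R}^4$ put $g_{ij}=\det(\nabla v^i,\nabla v^j)$, where $\nabla$ is the gradient in $z=(z_1,z_2)$. A constraint of $v$ is a relation $\sum_{1\le i<j\le4}\alpha_{ij}g_{ij}(z)=0$ holding for all $z\in D$ with real constants $\alpha_{ij}$; the hypothesis in (ii) says that the vector space of all such coefficient vectors $(\alpha_{ij})$ is two-dimensional, spanned by those of $g_{13}=0$ and $g_{24}=0$. $d\varphi$ is the $2\times2$ Jacobian matrix with respect to $z$ only. ''$\varphi$ gives a solution to the Euler equations'' means that the velocity field $u(x,t)$ determined (locally) by $\partial_t\varphi(z,t)=u(\varphi(z,t),t)$ satisfies, with some pressure $p$, the equations $u_t+(u\cdot\nabla)u+\nabla p=0$ and $\nabla\cdot u=0$. $\zeta$ denotes the vorticity in the $z$ coordinates, $\zeta=\hat\zeta\circ\varphi^t$ with $\varphi^t=\varphi(\cdot,t)$ and $\hat\zeta=\partial_{x_1}u^2-\partial_{x_2}u^1$.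
   Formalization: The sign of the vorticity in (i) is corrected to ζ = +2c(f1'+f2')/(1−f1'f2'); with ζ̂ = ∂_{x1}u²−∂_{x2}u¹ the printed minus sign fails, e.g. for c=1, f1(s)=as, f2=0, where u=(x1, 2a·x1−x2) has vorticity 2a. *)

(* Defs.v *)
From HB Require Import structures.
From mathcomp Require Export all_boot all_order all_algebra.
From mathcomp Require Export all_classical all_reals all_analysis.
Export numFieldNormedType.Exports.

Set Implicit Arguments.
Unset Strict Implicit.
Unset Printing Implicit Defensive.

Import Order.TTheory GRing.Theory Num.Theory.

Local Open Scope classical_set_scope.
Local Open Scope ring_scope.

(* Points of R^n are column vectors 'cV[R]_n, and coordinates are numbered from
   0: the mathematical v^1, ..., v^4 are v z 0 0, ..., v z 3 0. *)

(* On an open subset of a finite-dimensional space this is the usual class C^k: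
   the function and its iterated directional derivatives up to order k are
   continuous, those of order less than k being moreover differentiable.
   Nothing is required outside D. *)
Fixpoint Ck (R : realType) (V W : normedModType R) (k : nat)
    (D : set V) (f : V -> W) : Prop :=
  if k is k'.+1 then
    (forall x, D x -> differentiable f x) /\
    (forall v, Ck k' D (fun x => 'D_v f x))
  else forall x, D x -> {for x, continuous f}.

Definition smooth_on (R : realType) (V W : normedModType R)
    (D : set V) (f : V -> W) : Prop := forall k, Ck k D f.

Definition domain (R : realType) (D : set 'cV[R]_2) : Prop :=
  [/\ D !=set0, open D & connected D].

Definition open_interval (R : realType) (I : set R) : Prop :=
  [/\ I !=set0, open I & is_interval I].

Definition diffeomorphism (R : realType) (U V : set 'cV[R]_2)
    (psi : 'cV[R]_2 -> 'cV[R]_2) : Prop :=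
  [/\ open U, open V, set_bij U V psi, smooth_on U psi &
      exists chi : 'cV[R]_2 -> 'cV[R]_2,
        smooth_on V chi /\ (forall z, U z -> chi (psi z) = z)].

Definition partial (R : realType) (W : normedModType R) (j : 'I_2)
    (f : 'cV[R]_2 -> W) (z : 'cV[R]_2) : W :=
  'D_(delta_mx j 0 : 'cV[R]_2) f z.

Definition grad (R : realType) (f : 'cV[R]_2 -> R) (z : 'cV[R]_2) : 'cV[R]_2 :=
  \col_j partial j f z.

(* The library's jacobian acts on row vectors and is the transpose of this. *)
Definition jac (R : realType) (n : nat) (f : 'cV[R]_2 -> 'cV[R]_n)
    (z : 'cV[R]_2) : 'M[R]_(n, 2) :=
  \matrix_(i, j) partial j (fun w => f w i 0) z.

Definition M (R : realType) (theta : R) : 'M[R]_2 :=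
  \matrix_(i < 2, j < 2)
    nth 0 (nth [::] [:: [:: cos theta; - sin theta];
                        [:: sin theta;   cos theta]] i) j.

Definition Mhat (R : realType) (theta : R) : 'M[R]_2 :=
  \matrix_(i < 2, j < 2)
    nth 0 (nth [::] [:: [:: cos theta;   sin theta];
                        [:: sin theta; - cos theta]] i) j.

Definition Ac (R : realType) (c t : R) : 'M[R]_(2, 4) :=
  \matrix_(i < 2, j < 4)
    nth 0 (nth [::]
      [:: [:: expR (c * t); 0; 0; expR (- (c * t))];
          [:: 0; expR (- (c * t)); expR (c * t); 0]] i) j.

Definition graph_vec (R : realType) (f1 f2 : R -> R) (z : 'cV[R]_2) : 'cV[R]_4 :=
  \col_(i < 4) nth 0 [:: z 0 0; z 1 0; f1 (z 0 0); f2 (z 1 0)] i.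

Definition flow (R : realType) (A : R -> 'M[R]_(2, 4))
    (v : 'cV[R]_2 -> 'cV[R]_4) (z : 'cV[R]_2) (t : R) : 'cV[R]_2 :=
  A t *m v z.

Definition gdet (R : realType) (v : 'cV[R]_2 -> 'cV[R]_4) (i j : 'I_4)
    (z : 'cV[R]_2) : R :=
  \det (row_mx (grad (fun w => v w i 0) z) (grad (fun w => v w j 0) z) : 'M[R]_2).

(* Only the entries of alpha strictly above the diagonal are coefficients; the
   others are irrelevant. *)
Definition is_constraint (R : realType) (D : set 'cV[R]_2)
    (v : 'cV[R]_2 -> 'cV[R]_4) (alpha : 'M[R]_4) : Prop :=
  forall z, D z ->
    \sum_(i < 4) \sum_(j < 4 | (i < j)%N) alpha i j * gdet v i j z = 0.

Definition constraints_exactly_g13_g24 (R : realType) (D : set 'cV[R]_2)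
    (v : 'cV[R]_2 -> 'cV[R]_4) : Prop :=
  forall alpha : 'M[R]_4,
    is_constraint D v alpha <->
    exists a b : R, forall i j : 'I_4, (i < j)%N ->
      alpha i j = (a *: delta_mx 0 2 + b *: delta_mx 1 3 : 'M[R]_4) i j.

Definition columns_independent (R : realType) (I : set R)
    (A : R -> 'M[R]_(2, 4)) : Prop :=
  forall lambda : 'I_4 -> R,
    (forall t, I t -> \sum_j lambda j *: col j (A t) = 0) ->
    forall j, lambda j = 0.

Definition divergence (R : realType) (u : 'cV[R]_2 -> 'cV[R]_2)
    (x : 'cV[R]_2) : R :=
  \sum_i partial i (fun y => u y i 0) x.

(* Sign check: u(x) = (x_1, 2 a x_1 - x_2), the steady velocity field of
   flow (Ac 1) (graph_vec (fun s => a * s) (fun=> 0)), has vorticity 2 a. *)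
Definition vorticity (R : realType) (u : 'cV[R]_2 -> 'cV[R]_2)
    (x : 'cV[R]_2) : R :=
  partial 0 (fun y => u y 1 0) x - partial 1 (fun y => u y 0 0) x.

(* (w . nabla) u at x *)
Definition convect (R : realType) (w : 'cV[R]_2)
    (u : 'cV[R]_2 -> 'cV[R]_2) (x : 'cV[R]_2) : 'cV[R]_2 :=
  \sum_i w i 0 *: partial i u x.

Definition euler_on (R : realType) (Omega : set ('cV[R]_2 * R))
    (u : 'cV[R]_2 -> R -> 'cV[R]_2) (p : 'cV[R]_2 -> R -> R) : Prop :=
  [/\ smooth_on Omega (fun q => u q.1 q.2),
      smooth_on Omega (fun q => p q.1 q.2) &
      forall x t, Omega (x, t) ->
        derive1 (u x) t + convect (u x t) (u^~ t) x + grad (p^~ t) x = 0 /\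
        divergence (u^~ t) x = 0].

Definition swept (R : realType) (phi : 'cV[R]_2 -> R -> 'cV[R]_2)
    (W : set 'cV[R]_2) (J : set R) : set ('cV[R]_2 * R) :=
  [set q | exists2 z, W z & J q.2 /\ q.1 = phi z q.2].

(* The maps phi(., t) need not be injective on the whole of D, so a velocity
   field is attached to phi only near each (z0, t0). Openness of the swept
   region makes the derivatives of u on it depend on phi alone. *)
Definition local_velocity (R : realType) (D : set 'cV[R]_2) (I : set R)
    (phi : 'cV[R]_2 -> R -> 'cV[R]_2) (W : set 'cV[R]_2) (J : set R)
    (u : 'cV[R]_2 -> R -> 'cV[R]_2) : Prop :=
  [/\ open W /\ W `<=` D, open J /\ J `<=` I, open (swept phi W J),
      smooth_on (swept phi W J) (fun q => u q.1 q.2) &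
      forall z t, W z -> J t -> derive1 (phi z) t = u (phi z t) t].

Definition gives_euler_solution (R : realType) (D : set 'cV[R]_2) (I : set R)
    (phi : 'cV[R]_2 -> R -> 'cV[R]_2) : Prop :=
  forall z0 t0, D z0 -> I t0 ->
    exists W J u p, [/\ W z0, J t0, local_velocity D I phi W J u &
                        euler_on (swept phi W J) u p].

(* Main.v *)
From HB Require Import structures.
Require Import Defs.
From mathcomp Require Import ring lra.
Import Order.TTheory GRing.Theory Num.Theory.
Local Open Scope classical_set_scope.
Local Open Scope ring_scope.

Set Implicit Arguments.
Unset Strict Implicit.
Unset Printing Implicit Defensive.

(** Part (i): the acceleration of [Ac c t *m w] is [c ^+ 2] times the position,
    so the pressure [- c^2 |x|^2 / 2] works as soon as the velocity is
    divergence free; both the divergence and the vorticity are read off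
    [jac u *m P = P'], where [P] is the Jacobian of the flow at time [t].

    Part (ii): incompressibility and the symmetry of the Hessian of the pressure
    say that, for every [t], the derivatives of [det (a_i, a_j)] and of
    [a_i' . a_j - a_i . a_j'] ([a_i] being the columns of [A]) are coefficients of
    constraints of [v]. By hypothesis both quantities are then constant for
    [i = 1, 3] and [j = 2, 4]. Let [K] be the 2x2 matrix of these determinants.
    It is not zero, as the Jacobian of the flow would vanish, and if it had rank one
    then the columns would be dependent. Otherwise [a_1 / d] and
    [a_3 / d], with [d = det (a_1, a_3)], are combinations of [a_2] and [a_4], and
    the constancy of the second quantity gives [d = d_0 exp (2 c t)], a Gram matrix
    of [(a_1, a_3)] proportional to [d], and a constant angular velocity of
    [a_1 / |a_1|]; that is [A t = M (c_1 t + c_0) *m Ac c t *m B], where the constant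
    matrix [B] does not mix the indices 1, 3 with 2, 4. Hence [w := B v] still has
    [g_13 = g_24 = 0] and [g_12 - g_34 <> 0]: locally either [(w_1, w_2)] or
    [(w_3, w_4)] are coordinates, in which the two other components depend on one
    variable each. The second choice exchanges the two coordinates of the plane
    and accounts for [Mhat]. *)

(** * Differentials and C^k maps *)

Section Differentials.
Context {R : realType} {V W : normedModType R}.
Implicit Types (f g : V -> W) (x h : V).

Lemma differentiable_le f x : differentiable f x -> forall e, 0 < e ->
  \forall h \near 0, `|f (h + x) - f x - 'd f x h| <= e * `|h|.
Proof.
move=> /diff_locally /eqaddoP fx e e0; have := fx e e0.
by apply: filterS => h /=; rewrite /cst /= opprD addrA.
Qed.

(** Uniqueness of the differential turns an epsilon estimate into an identification of it. The
    differential of a local inverse is found in this way. *)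
Lemma is_diff_le f x (L : {linear V -> W}) : continuous L ->
  (forall e, 0 < e ->
     \forall h \near 0, `|f (h + x) - f x - L h| <= e * `|h|) ->
  is_diff x f L.
Proof.
move=> cL fL.
have fE : f \o shift x = cst (f x) + L +o_ 0 id.
  apply/eqaddoP => e e0; have := fL e e0.
  by apply: filterS => h /=; rewrite /cst /= opprD addrA.
have dE := diff_unique cL fE.
split => //; apply/diff_locallyP; split; first by rewrite dE.
by rewrite dE.
Qed.

Lemma near_eq_differentiable f g x :
  (\near x, f x = g x) -> differentiable f x -> differentiable g x.
Proof.
move=> fg df; suff: is_diff x g ('d f x) by case.
apply: is_diff_le; first exact: diff_continuous.
move=> e e0; have fgx := nbhs_singleton fg.
have fg' : \forall h \near (0 : V), f (h + x) = g (h + x).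
  by move: fg; rewrite (near_shift 0 x) /=; apply: filterS => h /=; rewrite subr0.
near=> h; rewrite -fgx -(near fg' h)//; near: h; exact: differentiable_le.
Unshelve. all: by end_near. Qed.

Lemma derive_shiftE f (b v x : V) : 'D_v (fun y => f (y + b)) x = 'D_v f (x + b).
Proof. rewrite /derive (_ : (fun h : R => h^-1 *: (f (h *: v + x + b : V) - f (x + b))) =
  fun h : R => h^-1 *: (f (h *: v + (x + b)) - f (x + b))) //.
by apply/funext => h; rewrite addrA. Qed.

Lemma differentiable_shift f b x :
  differentiable f (x + b) -> differentiable (fun y => f (y + b)) x.
Proof.
move=> df; suff: is_diff x (fun y => f (y + b)) ('d f (x + b)) by case.
apply: is_diff_le; first exact: diff_continuous.
move=> e e0; have := differentiable_le df e0; apply: filterS => h.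
by rewrite addrA.
Qed.

End Differentials.

(** * The mean value theorem along a segment *)

Section MeanValue.
Context {R : realType} {V : normedModType R}.
Implicit Types (f : V -> R).

(** One-variable mean value theorem for [s |-> f (a + s *: h)], whose derivative is the derivative
    of [f] in the direction [h]. *)
Lemma segment_MVT f (a h : V) :
  (forall s : R, 0 <= s <= 1 -> differentiable f (a + s *: h)) ->
  exists2 s : R, 0 < s < 1 & f (a + h) - f a = 'D_h f (a + s *: h).
Proof.
move=> df; pose g s := f (a + s *: h).
have dg (s : R) : 0 <= s <= 1 -> is_derive s 1 g ('D_h f (a + s *: h)).
  move=> s01; have dfs := df s s01.
  have E : (fun e : R => e^-1 *: (g (e *: 1 + s) - g s)) =
      (fun e => e^-1 *: (f (e *: h + (a + s *: h)) - f (a + s *: h))).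
    apply/funext => e; rewrite /g; congr (_ *: (f _ - _)).
    by rewrite [e *: 1]mulr1 scalerDl addrCA.
  split; first by rewrite /derivable E; exact: diff_derivable.
  by rewrite /derive E.
have [||s s01] := @MVT R g (fun s => 'D_h f (a + s *: h)) 0 1 ltr01.
- by move=> s; rewrite in_itv/= => /andP[s0 s1]; apply: dg; rewrite !ltW.
- apply: continuous_in_subspaceT => s; rewrite inE/= in_itv/= => s01.
  apply: differentiable_continuous; apply/derivable1_diffP.
  exact: (@ex_derive _ _ _ _ _ _ _ (dg s s01)).
rewrite subr0 mulr1 /g scale1r scale0r addr0 => E.
by exists s => //; rewrite in_itv/= in s01.
Qed.

End MeanValue.

(** * Stability of the classes C^k under algebraic operations *)

Section CkTheory.
Context {R : realType}.

Lemma derive_comp (V V' W : normedModType R) (g : V -> V') (f : V' -> W) x v :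
  differentiable g x -> differentiable f (g x) ->
  'D_v (fun y => f (g y)) x = 'D_('D_v g x) f (g x).
Proof.
move=> dg df; rewrite [LHS](deriveE _ (differentiable_comp dg df)).
by rewrite diff_comp //= !deriveE.
Qed.

Lemma derive_linear (V W : normedModType R) (L : {linear V -> W}) x v :
  continuous L -> 'D_v L x = L v.
Proof.
by move=> cL; rewrite deriveE ?diff_lin //; exact: linear_differentiable.
Qed.

Lemma CkS (V W : normedModType R) k (D : set V) (f : V -> W) :
  Ck k.+1 D f <->
  (forall x, D x -> differentiable f x) /\ (forall v, Ck k D ('D_v f)).
Proof. by []. Qed.

Lemma Ck_sub (V W : normedModType R) k (D D' : set V) (f : V -> W) :
  D' `<=` D -> Ck k D f -> Ck k D' f.
Proof.
move=> DD; elim: k f => [|k IH] f /=; first by move=> H x /DD /H.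
by move=> /CkS[df Df]; split=> [x /DD /df//|v]; apply: IH.
Qed.

Lemma Ck_continuous (V W : normedModType R) k (D : set V) (f : V -> W) :
  Ck k D f -> forall x, D x -> {for x, continuous f}.
Proof.
case: k => [//|k] /= [df _] x Dx; exact/differentiable_continuous/df.
Qed.

Lemma Ck_leS (V W : normedModType R) k (D : set V) (f : V -> W) :
  Ck k.+1 D f -> Ck k D f.
Proof.
elim: k f => [|k IH] f; first by move=> /Ck_continuous.
by move=> /CkS[df Df]; split=> // v; apply/IH/Df.
Qed.

(** On an open set, continuity and derivatives at a point only see nearby values. This allows a
    derivative to be replaced by a formula valid on [D] alone. *)
Lemma Ck_eq (V W : normedModType R) k (D : set V) (f g : V -> W) : open D ->
  (forall x, D x -> f x = g x) -> Ck k D f -> Ck k D g.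
Proof.
move=> oD; elim: k f g => [|k IH] f g fg.
  move=> /= fc x Dx; suff : g @ x --> f x by rewrite fg.
  apply: cvg_trans (fc x Dx); apply: near_eq_cvg.
  by near=> y; apply: fg; near: y; exact: open_nbhs_nbhs.
have nfg x : D x -> \near x, f x = g x.
  by move=> Dx; near=> y; apply: fg; near: y; exact: open_nbhs_nbhs.
move=> /CkS[df Df]; split=> [x Dx|v].
  exact: near_eq_differentiable (nfg x Dx) (df x Dx).
by apply: IH (Df v) => x Dx; apply: near_eq_derive; exact: nfg.
Unshelve. all: by end_near. Qed.

Lemma Ck_cst (V W : normedModType R) k (D : set V) (w : W) :
  Ck k D (fun=> w).
Proof.
elim: k w => [|k IH] w /=; first by move=> x _; exact: cvg_cst.
split=> [x _|v]; first exact: differentiable_cst.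
by under eq_fun do rewrite derive_cst; exact: IH.
Qed.

Lemma Ck_linear (V W : normedModType R) k (D : set V) (L : {linear V -> W}) :
  continuous L -> Ck k D L.
Proof.
move=> cL; case: k => [|k] /=; first by move=> x _; exact: cL.
split=> [x _|v]; first exact: linear_differentiable.
under eq_fun => x do rewrite derive_linear //.
exact: Ck_cst.
Qed.

Lemma Ck_linear_comp (V W X : normedModType R) k (D : set V)
    (L : {linear W -> X}) (f : V -> W) :
  open D -> continuous L -> Ck k D f -> Ck k D (fun x => L (f x)).
Proof.
move=> oD cL; elim: k f => [|k IH] f.
  by move=> fc x Dx; apply: continuous_comp; [exact: fc|exact: cL].
move=> /CkS[df Df]; have dL y : differentiable L y by exact: linear_differentiable.
split=> [x Dx|v]; first exact: (differentiable_comp (df x Dx) (dL _)).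
apply: Ck_eq (IH _ (Df v)) => // x Dx.
by rewrite [RHS]derive_comp ?derive_linear //; exact: df.
Qed.

Lemma Ck_id (V : normedModType R) k (D : set V) : Ck k D (fun x : V => x).
Proof. by apply: (@Ck_linear V V k D idfun) => x; exact: cvg_id. Qed.

Lemma CkN (V W : normedModType R) k (D : set V) (f : V -> W) :
  open D -> Ck k D f -> Ck k D (fun x => - f x).
Proof. by move=> oD; apply: (@Ck_linear_comp V W W k D -%R) => //; exact: opp_continuous. Qed.

Lemma CkD (V W : normedModType R) k (D : set V) (f g : V -> W) :
  open D -> Ck k D f -> Ck k D g -> Ck k D (fun x => f x + g x).
Proof.
move=> oD; elim: k f g => [|k IH] f g.
  by move=> fc gc x Dx; apply: cvgD; [exact: fc|exact: gc].
move=> /CkS[df Df] /CkS[dg Dg]; split=> [x Dx|v].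
  exact: (differentiableD (df x Dx) (dg x Dx)).
apply: Ck_eq (IH _ _ (Df v) (Dg v)) => // x Dx.
by rewrite -deriveD //; apply: diff_derivable; [exact: df|exact: dg].
Qed.

Lemma CkB (V W : normedModType R) k (D : set V) (f g : V -> W) :
  open D -> Ck k D f -> Ck k D g -> Ck k D (fun x => f x - g x).
Proof. by move=> oD fC gC; apply: CkD => //; exact: CkN. Qed.

Lemma Ck_sum (V W : normedModType R) k (D : set V) (I : Type) (r : seq I)
    (f : I -> V -> W) :
  open D -> (forall i, Ck k D (f i)) -> Ck k D (fun x => \sum_(i <- r) f i x).
Proof.
move=> oD fC; elim: r => [|i r IH].
  by under eq_fun do rewrite big_nil; exact: Ck_cst.
by under eq_fun do rewrite big_cons; exact: CkD.
Qed.

(** Induction through the Leibniz rule; the undifferentiated factors are brought down to order [k]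
    by [Ck_leS]. *)
Lemma CkM (V : normedModType R) k (D : set V) (f g : V -> R) :
  open D -> Ck k D f -> Ck k D g -> Ck k D (fun x => f x * g x).
Proof.
move=> oD; elim: k f g => [|k IH] f g.
  by move=> fc gc x Dx; apply: cvgM; [exact: fc|exact: gc].
move=> fC gC; have /CkS[df Df] := fC; have /CkS[dg Dg] := gC; split=> [x Dx|v].
  exact: (differentiableM (df x Dx) (dg x Dx)).
apply: (@Ck_eq _ _ _ _ (fun x => f x * 'D_v g x + g x * 'D_v f x)) => //.
  move=> x Dx; rewrite [RHS]deriveM //; apply: diff_derivable; [exact: df|exact: dg].
by apply: CkD => //; apply: IH => //; apply: Ck_leS.
Qed.

(** The derivative of [1 / f] contains [1 / f] again, one order lower, so the induction closes. *)
Lemma CkV (V : normedModType R) k (D : set V) (f : V -> R) :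
  open D -> (forall x, D x -> f x != 0) -> Ck k D f ->
  Ck k D (fun x => (f x)^-1).
Proof.
move=> oD f0; elim: k f f0 => [|k IH] f f0.
  by move=> fc x Dx; apply: cvgV; [exact: f0|exact: fc].
move=> fC; have /CkS[df Df] := fC; split=> [x Dx|v].
  by apply: differentiableV; [exact: df|exact: f0].
have iC : Ck k D (fun x => (f x)^-1) by apply: IH => //; exact: Ck_leS.
apply: (@Ck_eq _ _ _ _ (fun x => (- 1) * ((f x)^-1 * (f x)^-1 * 'D_v f x))) => //.
  move=> x Dx; rewrite [RHS]deriveV ?f0 //; last exact/diff_derivable/df.
  by rewrite mulN1r /GRing.scale /= expr2 invfM mulNr.
apply: CkM => //; first exact: Ck_cst.
by apply: CkM => //; apply: CkM.
Qed.

End CkTheory.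

(** * Coordinates in finite dimension and composition of C^k maps *)

Definition scale_vec (R : realType) (V : normedModType R) (w : V) (a : R) := a *: w.

Lemma scale_vec_is_linear (R : realType) (V : normedModType R) (w : V) :
  linear (scale_vec w).
Proof. by move=> a x y; rewrite /scale_vec scalerDl scalerA. Qed.

HB.instance Definition _ (R : realType) (V : normedModType R) (w : V) :=
  GRing.isLinear.Build R R V _ (scale_vec w) (scale_vec_is_linear w).

Lemma scale_vec_continuous (R : realType) (V : normedModType R) (w : V) :
  continuous (scale_vec w).
Proof. by move=> x; apply: cvgZr_tmp; exact: cvg_id. Qed.

(** Like [scale_vec], a named function, so that it can carry the structure of a linear map. *)
Definition mx_coord (R : realType) m n (i : 'I_m) (j : 'I_n) (N : 'M[R]_(m, n)) :=
  N i j.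

Lemma mx_coord_is_linear (R : realType) m n (i : 'I_m) (j : 'I_n) :
  linear (@mx_coord R m n i j : 'M[R]_(m, n) -> R).
Proof. by move=> a x y; rewrite /mx_coord !mxE. Qed.

HB.instance Definition _ (R : realType) m n (i : 'I_m) (j : 'I_n) :=
  GRing.isLinear.Build R 'M[R]_(m, n) R _ (mx_coord i j) (mx_coord_is_linear i j).

Lemma mx_coord_continuous (R : realType) m n (i : 'I_m) (j : 'I_n) :
  continuous (@mx_coord R m n i j).
Proof. exact: coord_continuous. Qed.

(* Finite dimension. The index type is an arbitrary finite type, so that the
   coordinates of a product are indexed by a sum. *)
Record coords (R : realType) (V : normedModType R) := Coords {
  cindex : finType;
  cbasis : cindex -> V;
  ccoord : cindex -> {linear V -> R};
  ccoord_cont : forall i, continuous (ccoord i);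
  ccoordE : forall h, h = \sum_i ccoord i h *: cbasis i }.

Arguments cbasis {R V} c i.
Arguments ccoord {R V} c i.

Section Coordinates.
Context {R : realType}.

Lemma derive_coords (V W : normedModType R) (c : coords V) (f : V -> W) x h :
  differentiable f x ->
  'D_h f x = \sum_(i : cindex c) ccoord c i h *: 'D_(cbasis c i) f x.
Proof.
move=> df; rewrite deriveE // {1}(ccoordE c h) linear_sum.
by apply: eq_bigr => i _; rewrite linearZ /= deriveE.
Qed.

(** The chain rule produces the derivative of [f] in the direction ['D_v g x], which varies with
    [x], whereas [Ck] speaks of fixed directions. Expanding this direction in a basis separates the
    two dependences. *)
Lemma Ck_comp_real (V V' : normedModType R) (c : coords V') k (D : set V)
    (D' : set V') (g : V -> V') (f : V' -> R) :
  open D -> (forall x, D x -> D' (g x)) -> Ck k D g -> Ck k D' f ->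
  Ck k D (fun x => f (g x)).
Proof.
move=> oD gD; elim: k f => [|k IH] f.
  by move=> gc fc x Dx; apply: continuous_comp; [exact: gc|exact/fc/gD].
move=> gC /CkS[df Df]; have /CkS[dg Dg] := gC; split=> [x Dx|v].
  by apply: differentiable_comp; [exact: dg|exact/df/gD].
apply: (@Ck_eq _ _ _ _ _ (fun x => \sum_(i : cindex c) ccoord c i ('D_v g x) *
    'D_(cbasis c i) f (g x))) => //.
  move=> x Dx; have dfx := df _ (gD _ Dx).
  by rewrite [RHS]derive_comp ?[RHS](derive_coords c) //; exact: dg.
apply: Ck_sum => // i; apply: CkM => //.
  by apply: Ck_linear_comp => //; exact: ccoord_cont.
by apply: (IH (fun y => 'D_(cbasis c i) f y)); [exact: Ck_leS|exact: Df].
Qed.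

Lemma Ck_coords (V W : normedModType R) (c : coords W) k (D : set V) (f : V -> W) :
  open D -> (forall i, Ck k D (fun x => ccoord c i (f x))) -> Ck k D f.
Proof.
move=> oD fC; rewrite (_ : f = fun x => \sum_(i : cindex c) ccoord c i (f x) *: cbasis c i).
  apply: Ck_sum => // i.
  apply: (@Ck_linear_comp _ V R W k D (scale_vec (cbasis c i))
    (fun x => ccoord c i (f x)) oD); [exact: scale_vec_continuous|exact: fC].
by apply/funext => x; exact: ccoordE.
Qed.

Lemma Ck_comp (V V' W : normedModType R) (c : coords V') (d : coords W) k
    (D : set V) (D' : set V') (g : V -> V') (f : V' -> W) :
  open D -> open D' -> (forall x, D x -> D' (g x)) -> Ck k D g -> Ck k D' f ->
  Ck k D (fun x => f (g x)).
Proof.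
move=> oD oD' gD gC fC; apply: (Ck_coords (c := d)) => // i.
apply: (Ck_comp_real c oD gD gC (f := fun y => ccoord d i (f y))).
by apply: Ck_linear_comp => //; exact: ccoord_cont.
Qed.

End Coordinates.

Definition coords_real (R : realType) : coords R.
Proof.
apply: (@Coords R R 'I_1 (fun=> 1) (fun=> idfun)).
- by move=> i x; exact: cvg_id.
- by move=> h; rewrite big_ord1 [_ *: _]mulr1.
Defined.

Definition coords_col (R : realType) n : coords 'cV[R]_n.
Proof.
apply: (@Coords R 'cV[R]_n 'I_n (fun i => delta_mx i 0)
  (fun i => mx_coord i 0)).
- by move=> i; exact: mx_coord_continuous.
- move=> h; rewrite {1}[h]matrix_sum_delta; apply: eq_bigr => i _.
  by rewrite big_ord1.
Defined.

Definition coords_prod (R : realType) (V W : normedModType R)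
  (c : coords V) (d : coords W) : coords (V * W)%type.
Proof.
apply: (@Coords R (V * W)%type (cindex c + cindex d)%type
  (fun i => match i with inl i => (cbasis c i, 0) | inr j => (0, cbasis d j) end)
  (fun i => match i with inl i => ccoord c i \o fst | inr j => ccoord d j \o snd end)).
- by case=> i x; apply: continuous_comp; [exact: cvg_fst|exact: ccoord_cont
    |exact: cvg_snd|exact: ccoord_cont].
- case=> x y; rewrite big_sumType /=; apply: injective_projections.
  + rewrite [RHS](raddfD fst) !(raddf_sum fst) /= [X in _ + X]big1 ?addr0.
      by rewrite {1}(ccoordE c x).
    by move=> i _; rewrite scaler0.
  + rewrite [RHS](raddfD snd) !(raddf_sum snd) /= [X in X + _]big1 ?add0r.
      by rewrite {1}(ccoordE d y).
    by move=> i _; rewrite scaler0.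
Defined.

Definition coords_mx (R : realType) m n : coords 'M[R]_(m, n).
Proof.
apply: (@Coords R 'M[R]_(m, n) ('I_m * 'I_n)%type (fun ij => delta_mx ij.1 ij.2)
  (fun ij => mx_coord ij.1 ij.2)).
- by move=> i; exact: mx_coord_continuous.
- by move=> h; rewrite {1}[h]matrix_sum_delta pair_bigA.
Defined.

(** Continuity for free in finite dimension; it serves for linear maps that are only known
    algebraically, such as the inverse of a derivative. *)
Lemma linear_coords_continuous (R : realType) (V W : normedModType R) (c : coords V)
  (L : {linear V -> W}) : continuous L.
Proof.
rewrite (_ : GRing.Linear.sort L =
    fun h => \sum_(i : cindex c) scale_vec (L (cbasis c i)) (ccoord c i h)).
  move=> h; apply: (@Ck_sum R V W 0 setT _ _ (fun i h =>
    scale_vec (L (cbasis c i)) (ccoord c i h)) openT) => // i y _.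
  by apply: continuous_comp; [exact: ccoord_cont|exact: scale_vec_continuous].
apply/funext => h; rewrite {1}(ccoordE c h) linear_sum.
by apply: eq_bigr => i _; rewrite linearZ.
Qed.

(** * Symmetry of second derivatives *)

Section Schwarz.
Context {R : realType} {V : normedModType R}.

Lemma nbhs_parallelogram (D : set V) (x u v : V) : nbhs x D ->
  exists2 r : R, 0 < r & forall a b : R, `|a| <= r -> `|b| <= r ->
    D (x + a *: u + b *: v).
Proof.
(* The summand 1 keeps the denominator positive when [u] and [v] vanish; the half leaves room for a
   strict inequality. *)
move=> /nbhs_ballP[e /= e0 De]; exists (e / 2 / (`|u| + `|v| + 1)).
  by rewrite !divr_gt0 // ltr_wpDl // addr_ge0.
move=> a b ar br; apply: De; rewrite -ball_normE /= distrC.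
have uv0 : 0 < `|u| + `|v| + 1 by rewrite ltr_wpDl // addr_ge0.
rewrite -[x + _ + _]addrA addrAC subrr add0r (le_lt_trans (ler_normD _ _)) // !normrZ.
rewrite (@le_lt_trans _ _ (e / 2 / (`|u| + `|v| + 1) * (`|u| + `|v| + 1))) //.
  rewrite !mulrDr mulr1 -[leLHS]addr0; apply: lerD.
    by apply: lerD; apply: ler_wpM2r.
  by rewrite !divr_ge0 ?ltW.
by rewrite divfK ?gt_eqF // ltr_pdivrMr // ltr_pMr // ltr1n.
Qed.

(** The mean value theorem is used twice: along [u] for the increment [g y = f (y + r *: v) - f y],
    then along [v] for ['D_u f]. *)
Lemma second_difference (D : set V) (f : V -> R) (u v x : V) (r : R) :
  open D -> Ck 2 D f -> 0 < r ->
  (forall a b : R, `|a| <= r -> `|b| <= r -> D (x + a *: u + b *: v)) ->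
  exists a b : R, [/\ `|a| <= r, `|b| <= r &
    f (x + r *: u + r *: v) - f (x + r *: u) - (f (x + r *: v) - f x) =
    r * r * 'D_v ('D_u f) (x + a *: u + b *: v)].
Proof.
move=> oD fC r0 Dr; have /CkS[df Df] := fC; have /CkS[dDf _] := Df u.
pose g y := f (y + r *: v) - f y.
have r1 (s : R) : 0 <= s <= 1 -> `|s * r| <= r.
  move=> /andP[s0 s1]; rewrite ger0_norm ?(mulr_ge0 s0 (ltW r0)) //.
  by rewrite ler_piMl // ltW.
have rr : `|r| <= r by rewrite ger0_norm // ltW.
have r00 : `|0 : R| <= r by rewrite normr0 ltW.
have dfv y : D (y + r *: v) -> differentiable (fun y => f (y + r *: v)) y.
  by move=> Dy; apply: differentiable_shift; exact: df.
have [s /andP[s0 s1] gE] : exists2 s : R, 0 < s < 1 &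
    g (x + r *: u) - g x = 'D_(r *: u) g (x + s *: (r *: u)).
  apply: segment_MVT => s s01; rewrite scalerA.
  apply: (@differentiableB _ _ _ (fun y => f (y + r *: v))).
    by apply: dfv; apply: Dr; rewrite ?r1.
  by have := Dr _ _ (r1 _ s01) r00; rewrite scale0r addr0 => /df.
have sr : `|s * r| <= r by apply: r1; rewrite !ltW.
have Dsr := Dr _ _ sr r00; rewrite scale0r addr0 in Dsr.
have Dsrr := Dr _ _ sr rr.
have E : 'D_(r *: u) g (x + (s * r) *: u) =
    r * ('D_u f (x + (s * r) *: u + r *: v) - 'D_u f (x + (s * r) *: u)).
  have dg : differentiable g (x + (s * r) *: u).
    by apply: (@differentiableB _ _ _ (fun y => f (y + r *: v))); [exact: dfv|exact: df].
  rewrite deriveE // linearZ /= -deriveE //; congr (_ * _).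
  rewrite deriveB ?derive_shiftE //; apply: diff_derivable; [exact: dfv|exact: df].
have [t /andP[t0 t1] hE] : exists2 t : R, 0 < t < 1 &
    'D_u f (x + (s * r) *: u + r *: v) - 'D_u f (x + (s * r) *: u) =
    'D_(r *: v) ('D_u f) (x + (s * r) *: u + t *: (r *: v)).
  apply: (@segment_MVT R V ('D_u f) (x + (s * r) *: u) (r *: v)) => t t01.
  by rewrite scalerA; apply: dDf; apply: Dr => //; exact: r1.
have tr : `|t * r| <= r by apply: r1; rewrite !ltW.
exists (s * r), (t * r); split => //.
rewrite -[LHS]/(g (x + r *: u) - g x) gE scalerA E hE scalerA.
by rewrite -mulrA; congr (_ * _); rewrite deriveE ?linearZ /= -?deriveE //;
  apply: dDf; apply: Dr.
Qed.

Lemma derive_sym (D : set V) (f : V -> R) (u v x : V) :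
  open D -> Ck 2 D f -> D x -> 'D_v ('D_u f) x = 'D_u ('D_v f) x.
Proof.
move=> oD fC Dx.
have dd w z : exists2 P : V -> R, forall y, P y = 'D_z ('D_w f) y & {for x, continuous P} /\
    forall r : R, 0 < r ->
    (forall a b : R, `|a| <= r -> `|b| <= r -> D (x + a *: w + b *: z)) ->
    exists a b : R, [/\ `|a| <= r, `|b| <= r &
    f (x + r *: w + r *: z) - f (x + r *: w) - (f (x + r *: z) - f x) =
    r * r * P (x + a *: w + b *: z)].
  exists ('D_z ('D_w f)) => //; split; last by move=> r; exact: second_difference.
  by have /CkS[_ /(_ w)/CkS[_ /(_ z)]] := fC; exact.
(* Both mixed derivatives are limits of the same second difference. *)
have [P PE [Pc Pr]] := dd u v; have [Q QE [Qc Qr]] := dd v u => {dd}.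
rewrite -PE -QE; apply/eqP; rewrite -subr_eq0 -normr_le0; apply/ler_addgt0Pl => e e0; rewrite addr0.
have e2 : 0 < e / 2 by rewrite divr_gt0.
move/cvgrPdist_le : Pc => /(_ _ e2) Pc; move/cvgrPdist_le : Qc => /(_ _ e2) Qc.
have [r r0 Br] := nbhs_parallelogram u v
  (filterI (open_nbhs_nbhs (conj oD Dx)) (filterI Pc Qc)).
have [|a [b [ar br E1]]] := Pr r r0; first by move=> a b ar br; have [] := Br a b ar br.
have [|a' [b' [ar' br' E2]]] := Qr r r0.
  by move=> a' b' ar' br'; rewrite addrAC; have [] := Br b' a' br' ar'.
have [_ [P1 _]] := Br a b ar br; have [_ [_ Q1]] := Br b' a' br' ar'.
have PQ : P (x + a *: u + b *: v) = Q (x + b' *: u + a' *: v).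
  apply: (@mulfI _ (r * r)); first by rewrite mulf_neq0 // gt_eqF.
  rewrite -E1 [x + b' *: u + _]addrAC -E2 [x + r *: v + _]addrAC; ring.
rewrite [e]splitr -(subrKA (P (x + a *: u + b *: v))).
rewrite (le_trans (ler_normD _ _)) // lerD //.
by rewrite PQ distrC.
Qed.

End Schwarz.

(** * The inverse function theorem *)

Section Inverse.
Context {R : realType} {V : completeNormedModType R} (c : coords V).

Lemma ccoord_bound : exists2 K : cindex c -> R,
  forall i, 0 <= K i & forall i h, `|ccoord c i h| <= K i * `|h|.
Proof.
have bnd i := linear_lipschitz (ccoord_cont (c:=c) (i:=i)).
exists (fun i => sval (cid2 (bnd i))) => i; case: cid2 => //= k k0 _.
exact: ltW.
Qed.

(** By continuity the coordinates of the finitely many basis derivatives are small near [x0]. The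
    mean value theorem is then applied to each coordinate of [f] separately, since it has no
    vector-valued form. *)
Lemma small_derivative_lipschitz (D : set V) (f : V -> V) (x0 : V) :
  open D -> Ck 1 D f -> D x0 -> (forall v, 'D_v f x0 = 0) ->
  forall e, 0 < e -> exists2 r : R, 0 < r & ball x0 r `<=` D /\
    forall x y, ball x0 r x -> ball x0 r y -> `|f x - f y| <= e * `|x - y|.
Proof.
move=> oD /CkS[df Df] Dx0 Df0 e e0; have [K K0 cK] := ccoord_bound.
pose S := \sum_(i : cindex c) \sum_(j : cindex c) K j * `|cbasis c i|.
have S0 : 0 <= S.
  by apply: sumr_ge0 => i _; apply: sumr_ge0 => j _; exact: mulr_ge0.
(* Bounding every basis derivative coordinate by [d] yields the Lipschitz constant [d * S], which is
   at most [e]. *)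
pose d := e / (S + 1); have S1 : 0 < S + 1 by rewrite ltr_wpDl.
have d0 : 0 < d by rewrite divr_gt0.
have : \forall x \near x0, D x /\ forall ij : cindex c * cindex c,
    `|ccoord c ij.1 ('D_(cbasis c ij.2) f x)| <= d.
  near=> x; split; first by near: x; exact: open_nbhs_nbhs.
  near: x; apply: filter_forall => -[i j] /=.
  have cf : {for x0, continuous (fun x => ccoord c i ('D_(cbasis c j) f x))}.
    by apply: continuous_comp; [exact: Df|exact: ccoord_cont].
  move/cvgrPdist_le : cf => /(_ d d0); apply: filterS => x.
  by rewrite Df0 linear0 sub0r normrN.
move=> /nbhs_ballP[r /= r0 Br]; exists r => //; split; first by move=> x /Br[].
move=> x y bx by_.
have seg (s : R) : 0 <= s <= 1 -> ball x0 r (y + s *: (x - y)).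
  move=> /andP[s0 s1]; move: bx by_; rewrite -!ball_normE /= => bx by_.
  have -> : x0 - (y + s *: (x - y)) = s *: (x0 - x) + (1 - s) *: (x0 - y).
    rewrite scalerBl scale1r addrCA -scalerBr opprD -scalerN opprB addrA.
    by congr (_ + _ *: _); rewrite opprB [RHS]addrC addrA subrK.
  (* The strict inequality is taken from the first term of the convex combination, which requires
     [s] to be nonzero. *)
  have [s00|s00] := eqVneq s 0.
    by rewrite s00 scale0r add0r subr0 scale1r.
  rewrite (le_lt_trans (ler_normD _ _)) // !normrZ.
  rewrite (ger0_norm s0) ger0_norm ?subr_ge0 //.
  rewrite (@lt_le_trans _ _ (s * r + (1 - s) * r)) //; last first.
    by rewrite -mulrDl addrC subrK mul1r.
  by apply: ltr_leD; [rewrite ltr_pM2l // lt_neqAle eq_sym s00|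
    rewrite ler_wpM2l ?subr_ge0 // ltW].
have cb i : `|ccoord c i (f x - f y)| <= \sum_j d * (K j * `|x - y|).
  have [s s01 E] : exists2 s : R, 0 < s < 1 &
      ccoord c i (f (y + (x - y))) - ccoord c i (f y) =
      'D_(x - y) (fun x => ccoord c i (f x)) (y + s *: (x - y)).
    apply: (@segment_MVT _ _ (fun x => ccoord c i (f x))) => s s01.
    apply: differentiable_comp; first by apply: df; have [] := Br _ (seg s s01).
    by apply: linear_differentiable; exact: ccoord_cont.
  have /andP[/ltW s0 /ltW s1] := s01.
  have [|Ds Bs] := Br (y + s *: (x - y)); first by apply: seg; rewrite s0.
  rewrite linearB /= -{1}(subrKC y x) E derive_comp; last 2 first.
  - exact: df.
  - by apply: linear_differentiable; exact: ccoord_cont.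
  rewrite derive_linear; last exact: ccoord_cont.
  rewrite (derive_coords c); last exact: df.
  rewrite linear_sum (le_trans (ler_norm_sum _ _ _)) // ler_sum // => j _.
  rewrite linearZ /= normrM mulrC; apply: ler_pM => //.
  exact: (Bs (i, j)).
rewrite {1}(ccoordE c (f x - f y)) (le_trans (ler_norm_sum _ _ _)) //.
rewrite (@le_trans _ _ (\sum_i \sum_j d * (K j * `|x - y|) * `|cbasis c i|)) //.
  by apply: ler_sum => i _; rewrite normrZ -mulr_suml ler_wpM2r.
rewrite (_ : \sum_i _ = d * S * `|x - y|); last first.
  rewrite /S mulr_sumr mulr_suml; apply: eq_bigr => i _.
  rewrite mulr_sumr mulr_suml; apply: eq_bigr => j _.
  by ring.
apply: ler_wpM2r => //; rewrite /d -mulrA ler_piMr ?ltW //.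
by rewrite mulrC ltr_pdivrMr // mul1r ltrDl.
Unshelve. all: by end_near. Qed.


Section LocalInverse.
Variables (D : set V) (F : V -> V) (H : V -> V -> V).
Hypotheses (oD : open D) (F1 : Ck 1 D F).
Hypothesis HK : forall x v, D x -> H x ('D_v F x) = v.
Hypothesis KH : forall x v, D x -> 'D_(H x v) F x = v.

Let dF x : D x -> differentiable F x. Proof. by have /CkS[dF _] := F1; exact: dF. Qed.

(** [H x] is the inverse of the derivative at [x]. A two-sided inverse of a linear map is linear,
    hence continuous in finite dimension. *)
Lemma derive_inv_linear x : D x ->
  exists2 L : {linear V -> V}, continuous L & H x = L.
Proof.
move=> Dx.
have HL : linear (H x).
  move=> a u v; rewrite -[RHS](HK _ Dx); congr (H x _).
  by rewrite (deriveE _ (dF Dx)) linearD linearZ /= -!(deriveE _ (dF Dx)) !KH.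
pose L : {linear V -> V} := HB.pack (H x) (GRing.isLinear.Build _ _ _ _ _ HL).
by exists L => //; exact: linear_coords_continuous c L.
Qed.

(* Apply the Lipschitz bound to [x - H x0 (F x)], whose derivative vanishes at
   [x0]. *)
Lemma near_isometry x0 : D x0 ->
  exists2 r : R, 0 < r & ball x0 r `<=` D /\
    forall x y, ball x0 r x -> ball x0 r y ->
      `|(x - y) - (H x0 (F x) - H x0 (F y))| <= 2^-1 * `|x - y|.
Proof.
move=> Dx0; have [L cL LE] := derive_inv_linear Dx0.
have dL y : differentiable L y by exact: linear_differentiable.
pose f x := x - L (F x).
have Cf : Ck 1 D f.
  apply: CkD => //; first exact: Ck_id.
  apply: CkN => //.
  exact: (@Ck_linear_comp _ V V V 1 D L F).
have Df v : 'D_v f x0 = 0.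
  rewrite /f deriveB; last 2 first.
  - exact: derivable_id.
  - by apply: diff_derivable; apply: differentiable_comp => //; exact: dF.
  rewrite derive_id derive_comp ?derive_linear //; last exact: dF.
  by rewrite -LE HK // subrr.
have h2 : 0 < 2^-1 :> R by rewrite invr_gt0.
have [r r0 [rD rf]] := small_derivative_lipschitz oD Cf Dx0 Df h2.
exists r => //; split => // x y bx by_.
apply: le_trans (rf x y bx by_); rewrite /f LE.
by rewrite !opprD !opprK addrACA.
Qed.

(** To solve [F p = y] for [y] near [F x1], Newton's map [T] with the derivative frozen at [x0] is
    iterated. It is a contraction of the closed ball [B], and a fixed point satisfies
    [H x0 (F p) = H x0 y]. *)
Lemma near_isometry_open x0 (r : R) (U : set V) : D x0 ->
  (forall x y, ball x0 r x -> ball x0 r y ->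
      `|(x - y) - (H x0 (F x) - H x0 (F y))| <= 2^-1 * `|x - y|) ->
  open U -> U `<=` ball x0 r -> open (F @` U).
Proof.
move=> Dx0 iso oU Ur; have [L cL LE] := derive_inv_linear Dx0.
rewrite openE => _ [x1 Ux1 <-] /=.
have /nbhs_ballP[s /= s0 sU] := open_nbhs_nbhs (conj oU Ux1).
(* [T] moves the centre [x1] by at most [s / 4] and halves distances, so it maps the ball [B] of
   radius [s / 2] into itself. *)
have s4 : 0 < s / 2 / 2 by rewrite !divr_gt0.
have Lc : {for F x1, continuous (fun y => L (F x1) - L y)}.
  by apply: continuousB; [exact: cvg_cst|exact: cL].
move/cvgrPdist_le : Lc => /(_ _ s4); apply: filterS => y.
rewrite subrr sub0r normrN => Ly.
pose T x := x - (L (F x) - L y).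
pose B := [set x : V | `|x - x1| <= s / 2].
have BU x : B x -> U x.
  move=> Bx; apply: sU; rewrite -ball_normE /= distrC (le_lt_trans Bx) //.
  by rewrite ltr_pdivrMr // ltr_pMr // ltr1n.
have TT x z : B x -> B z -> `|T x - T z| <= 2^-1 * `|x - z|.
  move=> /BU/Ur Bx /BU/Ur Bz; apply: le_trans (iso x z Bx Bz); rewrite LE /T.
  suff -> : x - (L (F x) - L y) - (z - (L (F z) - L y)) =
      x - z - (L (F x) - L (F z)) by [].
  rewrite ![- (_ - _)]opprD !opprK !addrA addrAC; congr (_ + _).
  by rewrite [LHS]addrAC addrK addrAC.
have Bx1 : B x1 by rewrite /B /= subrr normr0 divr_ge0 // ltW.
have TB : {homo T : x / B x >-> B x}.
  move=> x Bx; rewrite /B /= -(subrKA (T x1)) [s / 2]splitr.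
  rewrite (le_trans (ler_normD _ _)) // lerD //.
    rewrite (le_trans (TT _ _ Bx Bx1)) // mulrC ler_pM2r //.
  by rewrite /T addrAC subrr add0r normrN.
pose TF : {fun B >-> B} := HB.pack T (@isFun.Build _ _ B B T TB).
have [|||p Bp pE] := @banach_fixed_point R V B TF.
- by exists (2^-1)%:nng; split=> [|[x z] [/= Bx Bz]];
   [rewrite /= invf_lt1 // ltr1n|exact: TT].
- rewrite (_ : B = (fun x => `|x - x1|) @^-1` [set z | z <= s / 2]) //.
  apply: closed_comp; last exact: closed_le.
  move=> x _; apply: (@continuous_comp _ _ _ (fun z : V => z - x1) (fun z : V => `|z|)).
    by apply: continuousB; [exact: cvg_id|exact: cvg_cst].
  exact: norm_continuous.
- by exists x1.
exists p; first exact: BU.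
have E : H x0 (F p) = H x0 y.
  move: pE; rewrite [X in _ = X]/(T p) /T -[X in X = _]subr0 => /addrI/oppr_inj/esym/eqP.
  by rewrite subr_eq0 LE => /eqP.
by rewrite -(KH (F p) Dx0) E KH.
Qed.

(** The estimate of [near_isometry] makes [F] injective with Lipschitz inverse on the ball, and the
    image open. The derivative of the inverse at [y] is [H (g y)], from which its regularity is
    bootstrapped. *)
Theorem inverse_function x0 : D x0 -> (forall v k, Ck k D (H^~ v)) ->
  exists r g, [/\ 0 < r, ball x0 r `<=` D,
    forall U, open U -> U `<=` ball x0 r -> open (F @` U),
    forall x, ball x0 r x -> g (F x) = x &
    forall k, Ck k (F @` ball x0 r) g].
Proof.
move=> Dx0 HC; have [r r0 [rD iso]] := near_isometry Dx0.
have [L cL LE] := derive_inv_linear Dx0.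
have opU U : open U -> U `<=` ball x0 r -> open (F @` U).
  by move=> oU Ur; exact: near_isometry_open Dx0 iso oU Ur.
have [k0 k00 Lk] := linear_lipschitz cL.
(* Obtained from [|x - y| <= |x - y| / 2 + k0 |F x - F y|] by absorbing the first term. *)
pose C := 2 * k0; have C0 : 0 < C by rewrite mulr_gt0.
have lip x y : ball x0 r x -> ball x0 r y -> `|x - y| <= C * `|F x - F y|.
  move=> bx by_; have := iso x y bx by_; rewrite LE -linearB => h.
  have : `|x - y| <= 2^-1 * `|x - y| + k0 * `|F x - F y|.
    rewrite -[X in `|X| <= _](subrK (L (F x - F y))).
    by rewrite (le_trans (ler_normD _ _)) // lerD.
  rewrite /C; lra.
pose g y := get [set x | ball x0 r x /\ F x = y].
have gF x : ball x0 r x -> g (F x) = x.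
  move=> bx; have [|bg Fg] := @getPex _ [set z | ball x0 r z /\ F z = F x].
    by exists x.
  apply/eqP; rewrite -subr_eq0 -normr_le0.
  by rewrite (le_trans (lip _ _ bg bx)) // Fg subrr normr0 mulr0.
have oB : open (F @` ball x0 r) by apply: opU => //; exact: ball_open.
have dg y : (F @` ball x0 r) y -> is_diff y g (H (g y)).
  move=> [x bx <-]; rewrite gF //; have Dx := rD x bx.
  have [Lx cLx LxE] := derive_inv_linear Dx; rewrite LxE; apply: is_diff_le => // e e0.
  have [k k00' Lxk] := linear_lipschitz cLx.
  (* The error of [F] is multiplied by [k] through the inverse derivative, and by [C] when
     [|x' - x|] is bounded by [C |h|]. *)
  have e'0 : 0 < e / (k * C) by rewrite divr_gt0 // mulr_gt0.
  have /nbhs_ballP[d /= d0 dP] := differentiable_le (dF Dx) e'0.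
  have nF : \forall h \near (0 : V), (F @` ball x0 r) (h + F x).
    have : \forall z \near F x, (F @` ball x0 r) z.
      by apply: open_nbhs_nbhs; split => //; exists x.
    by rewrite (near_shift 0 (F x)) /=; apply: filterS => h /=; rewrite subr0.
  have nd : \forall h \near (0 : V), `|h| < d / C.
    by apply: nbhs0_lt; rewrite divr_gt0.
  apply: filterS2 nF nd => h [x' bx' hE] hd.
  rewrite -hE !gF // -[h](addrK (F x)) -hE.
  have xx := lip x' x bx' bx; rewrite hE addrK in xx.
  have xd : ball 0 d (x' - x).
    rewrite -ball_normE /= sub0r normrN (le_lt_trans xx) // mulrC.
    by rewrite -ltr_pdivlMr.
  have := dP _ xd; rewrite subrK => Fd.
  rewrite -[X in X - _](HK (x' - x) Dx) LxE -linearB.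
  rewrite (le_trans (Lxk _)) // distrC.
  rewrite (@le_trans _ _ (k * (e / (k * C) * (C * `|h|)))) //.
    apply: ler_wpM2l; first exact: ltW.
    rewrite (deriveE _ (dF Dx)); apply: (le_trans Fd).
    by apply: ler_wpM2l => //; exact: ltW.
  rewrite hE addrK le_eqVlt; apply/orP; left; apply/eqP; field.
  by rewrite !gt_eqF.
exists r, g; split => //.
elim=> [|k IH].
  by move=> y /dg dgy; apply: differentiable_continuous; exact: ex_diff.
apply/CkS; split=> [y /dg dgy|v]; first exact: ex_diff.
(* If [g] is of class C^k, so is its derivative [H (g y) v], hence [g] is of class C^(k+1). *)
apply: (@Ck_eq _ _ _ _ _ (fun y => H (g y) v)) => //.
  move=> y By; have dgy := dg y By.
  by rewrite deriveE ?diff_val //; exact: ex_diff.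
apply: (@Ck_comp _ _ _ _ c c k _ D g (H^~ v)) => //.
by move=> y [x bx <-]; rewrite gF //; exact: rD.
Qed.

End LocalInverse.

End Inverse.

(* The library declares no pointed uniform structure on products, which the
   completeness instance needs. *)
HB.saturate prod.

Lemma prod_complete (R : realType) (V W : completeNormedModType R)
    (F : set_system (V * W)) : ProperFilter F -> cauchy F -> cvg F.
Proof.
move=> FF /cauchy_ballP Fc.
have F1 : cvg (fst @ F).
  apply: cauchy_cvg; apply/cauchy_ballP => e e0.
  case: (Fc e e0) => -[P Q] /= [FP FQ] PQ; exists (fst @` P, fst @` Q) => /=.
    by split; [apply: filterS FP|apply: filterS FQ] => x /= Px; exists x.
  by move=> -[_ _] /= [[x Px <-] [y Qy <-]]; have [] := PQ (x, y) (conj Px Qy).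
have F2 : cvg (snd @ F).
  apply: cauchy_cvg; apply/cauchy_ballP => e e0.
  case: (Fc e e0) => -[P Q] /= [FP FQ] PQ; exists (snd @` P, snd @` Q) => /=.
    by split; [apply: filterS FP|apply: filterS FQ] => x /= Px; exists x.
  by move=> -[_ _] /= [[x Px <-] [y Qy <-]]; have [] := PQ (x, y) (conj Px Qy).
apply/cvg_ex; exists (lim (fst @ F), lim (snd @ F)).
have H : (x.1, x.2) @[x --> F] --> (lim (fst @ F), lim (snd @ F)).
  exact: (cvg_pair F1 F2).
by move=> P /H; rewrite /nbhs /=; apply: filterS => -[].
Qed.

HB.instance Definition _ (R : realType) (V W : completeNormedModType R) :=
  Uniform_isComplete.Build (V * W)%type (@prod_complete R V W).

HB.instance Definition _ (R : realType) (m n : nat) :=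
  Complete.on 'M[R]_(m, n).

(** * Partial derivatives of functions of space and time *)

Section Slices.
Context {R : realType} {V W : normedModType R}.
Implicit Types (u : V -> R -> W).

Lemma derive_slicel u x t h :
  'D_h (u^~ t) x = 'D_(h, 0) (fun q => u q.1 q.2) (x, t).
Proof.
rewrite /derive (_ : (fun k : R => k^-1 *: (u (k *: h + x) t - u x t)) =
  (fun k : R => k^-1 *: (u (k *: (h, 0 : R) + (x, t)).1 (k *: (h, 0 : R) + (x, t)).2 - u x t))) //.
by apply/funext => k /=; rewrite scaler0 add0r.
Qed.

Lemma derive_slicer u x t :
  'D_1 (u x) t = 'D_(0, 1) (fun q => u q.1 q.2) (x, t).
Proof.
rewrite /derive (_ : (fun k : R => k^-1 *: (u x (k *: 1 + t) - u x t)) =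
  (fun k : R => k^-1 *: (u (k *: (0 : V, 1 : R) + (x, t)).1
     (k *: (0 : V, 1 : R) + (x, t)).2 - u x t))) //.
by apply/funext => k /=; rewrite scaler0 add0r.
Qed.

Lemma differentiable_slicel u x t :
  differentiable (fun q => u q.1 q.2) (x, t) -> differentiable (u^~ t) x.
Proof.
move=> du.
have dp : differentiable (fun y : V => (y, t)) x.
  by apply: (@differentiable_pair _ _ _ _ (fun y : V => y) (fun=> t)) => //; exact: ex_diff.
exact: (differentiable_comp dp (g := fun q => u q.1 q.2) du).
Qed.

Lemma derive_pair (X : normedModType R) (f : X -> V) (g : X -> W) x v :
  differentiable f x -> differentiable g x ->
  'D_v (fun y => (f y, g y)) x = ('D_v f x, 'D_v g x).
Proof.
move=> df dg; rewrite deriveE; last exact: differentiable_pair.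
by rewrite diff_pair //= !deriveE.
Qed.

Lemma differentiable_linear_comp (X : normedModType R) (L : {linear V -> W}) (f : X -> V) x :
  continuous L -> differentiable f x -> differentiable (fun y => L (f y)) x.
Proof.
move=> cL df; apply: differentiable_comp => //; exact: linear_differentiable.
Qed.

Lemma derive_linear_comp (X : normedModType R) (L : {linear V -> W}) (f : X -> V) x v :
  continuous L -> differentiable f x -> 'D_v (fun y => L (f y)) x = L ('D_v f x).
Proof.
move=> cL df; rewrite derive_comp ?derive_linear //; exact: linear_differentiable.
Qed.
End Slices.

(** * Jacobian matrices and matrix products *)

Section Jacobian.
Context {R : realType}.

Lemma mulmx_continuous m n (N : 'M[R]_(m, n)) :
  continuous (mulmx N : 'cV[R]_n -> 'cV[R]_m).
Proof. exact: (linear_coords_continuous (coords_col R n)). Qed.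

Lemma mulmxr_continuous m n (w : 'cV[R]_n) :
  continuous (mulmxr w : 'M[R]_(m, n) -> 'cV[R]_m).
Proof. exact: (linear_coords_continuous (coords_mx R m n)). Qed.

Lemma differentiable_mulmx (V : normedModType R) m n (N : 'M[R]_(m, n))
    (f : V -> 'cV[R]_n) z :
  differentiable f z -> differentiable (fun w => N *m f w) z.
Proof.
by apply: (differentiable_linear_comp (L := mulmx N)); exact: mulmx_continuous.
Qed.

Lemma differentiable_mulmxr (V : normedModType R) m n (N : V -> 'M[R]_(m, n))
    (w : 'cV[R]_n) z :
  differentiable N z -> differentiable (fun t => N t *m w) z.
Proof.
by apply: (differentiable_linear_comp (L := mulmxr w)); exact: mulmxr_continuous.
Qed.

Lemma derive1_mulmx m n (B : R -> 'M[R]_(m, n)) (w : 'cV[R]_n) t :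
  differentiable B t -> derive1 (fun s => B s *m w) t = derive1 B t *m w.
Proof.
move=> dB; rewrite !derive1E (derive_linear_comp (L := mulmxr w)) //.
exact: mulmxr_continuous.
Qed.

Lemma partial_coord n (f : 'cV[R]_2 -> 'cV[R]_n) i j z : differentiable f z ->
  partial j (fun w => f w i 0) z = (partial j f z) i 0.
Proof.
move=> df; rewrite /partial.
exact: (derive_linear_comp (L := mx_coord i 0) _ (@mx_coord_continuous R n 1 i 0) df).
Qed.

Lemma jacE n (f : 'cV[R]_2 -> 'cV[R]_n) z i j : differentiable f z ->
  jac f z i j = (partial j f z) i 0.
Proof. by move=> df; rewrite mxE partial_coord. Qed.

Lemma jac_comp n (f : 'cV[R]_2 -> 'cV[R]_n) (g : 'cV[R]_2 -> 'cV[R]_2) z :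
  differentiable g z -> differentiable f (g z) ->
  jac (fun w => f (g w)) z = jac f (g z) *m jac g z.
Proof.
move=> dg df; apply/matrixP => i j.
have dfg : differentiable (fun w => f (g w)) z by exact: differentiable_comp.
rewrite jacE // /partial derive_comp // (derive_coords (coords_col R 2)) //.
rewrite summxE mxE; apply: eq_bigr => k _ /=.
by rewrite !mxE mulrC !partial_coord.
Qed.

Lemma jac_mulmx m n (N : 'M[R]_(m, n)) (f : 'cV[R]_2 -> 'cV[R]_n) z :
  differentiable f z -> jac (fun w => N *m f w) z = N *m jac f z.
Proof.
move=> df; have cN := @mulmx_continuous m n N.
have dN := differentiable_mulmx N df; apply/matrixP => i j; rewrite jacE // /partial.
rewrite (derive_linear_comp (L := mulmx N)) // !mxE.
by apply: eq_bigr => k _; rewrite mxE partial_coord.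
Qed.

Lemma near_eq_jac n (f g : 'cV[R]_2 -> 'cV[R]_n) z :
  (\near z, f z = g z) -> jac f z = jac g z.
Proof.
move=> fg; apply/matrixP => i j; rewrite !mxE; apply: near_eq_derive.
by apply: filterS fg => w ->.
Qed.

End Jacobian.

(** * Consequences of the equation defining the velocity *)

Section Velocity.
Context {R : realType}.
Variables (D : set 'cV[R]_2) (I : set R) (A : R -> 'M[R]_(2, 4)).
Variable v : 'cV[R]_2 -> 'cV[R]_4.
Hypotheses (A2 : Ck 2 I A) (v1 : Ck 1 D v).
Variables (W : set 'cV[R]_2) (J : set R) (u : 'cV[R]_2 -> R -> 'cV[R]_2).
Hypothesis uP : local_velocity D I (flow A v) W J u.

Let x z t := flow A v z t.

Lemma swept_in z t : W z -> J t -> swept (flow A v) W J (x z t, t).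
Proof. by move=> Wz Jt; exists z. Qed.

Lemma differentiable_velocity z t : W z -> J t ->
  differentiable (fun q => u q.1 q.2) (x z t, t).
Proof.
move=> Wz Jt; have [_ _ _ /(_ 1%N)/CkS[du _] _] := uP.
by apply: du; exact: swept_in.
Qed.

Lemma differentiable_A t : I t -> differentiable A t.
Proof. by have /CkS[dA _] := A2; exact: dA. Qed.

(** Differentiate [u (A t *m v z) t = A' t *m v z] with respect to [z]. The identity holds for all
    [z] in the open set [W], so both sides have the same Jacobian. *)
Lemma velocity_jac z t : W z -> J t ->
  jac (u^~ t) (x z t) *m (A t *m jac v z) = derive1 A t *m jac v z.
Proof.
move=> Wz Jt; have [[oW WD] [oJ JI] _ _ uE] := uP.
have dv : differentiable v z by have /CkS[dv _] := v1; exact/dv/WD.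
have dx : differentiable (x^~ t) z by exact: differentiable_mulmx.
have du := differentiable_slicel (differentiable_velocity Wz Jt).
have := jac_comp dx du; rewrite (jac_mulmx (A t) dv : jac (x^~ t) z = _) => <-.
rewrite -jac_mulmx //.
apply: near_eq_jac; near=> w; rewrite -uE //; last by near: w; exact: open_nbhs_nbhs.
by rewrite derive1_mulmx //; exact/differentiable_A/JI.
Unshelve. all: by end_near. Qed.

(** The material derivative of [u] is the second time derivative of the trajectory: differentiate
    the same identity with respect to [t]. *)
Lemma velocity_acc z t : W z -> J t ->
  derive1 (u (x z t)) t + convect (u (x z t) t) (u^~ t) (x z t) =
  derive1 (derive1 A) t *m v z.
Proof.
move=> Wz Jt; have [[oW WD] [oJ JI] _ _ uE] := uP.
have du := differentiable_velocity Wz Jt.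
have dA := differentiable_A (JI _ Jt).
have dA' : differentiable (derive1 A) t.
  have -> : derive1 A = 'D_1 A by apply/funext => s; rewrite derive1E.
  by have /CkS[_ /(_ 1)/CkS[dA' _]] := A2; exact/dA'/JI.
have dx : differentiable (x z) t by exact: differentiable_mulmxr.
rewrite -derive1_mulmx // [RHS]derive1E.
rewrite (@near_eq_derive _ _ _ _ (fun s => u (x z s) s)); last first.
  near=> s; have Js : J s by near: s; exact: open_nbhs_nbhs.
  by rewrite -uE // derive1_mulmx //; exact/differentiable_A/JI.
have dp : differentiable (fun s => (x z s, s)) t.
  by apply: (@differentiable_pair _ _ _ _ (x z) (fun s : R => s)) => //; exact: ex_diff.
rewrite (derive_comp (g := fun s => (x z s, s)) (f := fun q => u q.1 q.2)) //.
rewrite derive_pair // derive_id -derive1E derive1_mulmx //.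
have -> : u (x z t) t = derive1 A t *m v z by rewrite -uE // derive1_mulmx.
set w := _ *m v z.
(* The tangent of the space-time trajectory splits into a spatial part, giving the convective term,
   and a temporal part, giving the time derivative of [u]. *)
have -> : (w, 1) = (w, 0) + (0, 1) :> 'cV[R]_2 * R by congr pair; rewrite ?addr0 ?add0r.
rewrite deriveE // linearD -!deriveE // addrC; congr (_ + _).
  rewrite -derive_slicel (derive_coords (coords_col R 2)) //.
  exact: differentiable_slicel.
by rewrite -derive_slicer derive1E.
Unshelve. all: by end_near. Qed.

End Velocity.

(** * C^k maps with matrix values *)

Section CkMatrix.
Context {R : realType}.

Lemma Ck_mx (V : normedModType R) m n k (D : set V) (f : V -> 'M[R]_(m, n)) :
  open D -> (forall i j, Ck k D (fun x => f x i j)) -> Ck k D f.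
Proof. by move=> oD fC; apply: (Ck_coords (c := coords_mx R m n)) => // -[i j]; exact: fC. Qed.

Lemma Ck_entry (V : normedModType R) m n k (D : set V) (f : V -> 'M[R]_(m, n)) i j :
  open D -> Ck k D f -> Ck k D (fun x => f x i j).
Proof.
by move=> oD; apply: (@Ck_linear_comp _ _ _ _ _ _ (mx_coord i j)) => //; exact: mx_coord_continuous.
Qed.

Lemma Ck_prod (V : normedModType R) k (D : set V) (I : Type) (r : seq I)
    (f : I -> V -> R) :
  open D -> (forall i, Ck k D (f i)) -> Ck k D (fun x => \prod_(i <- r) f i x).
Proof.
move=> oD fC; elim: r => [|i r IH].
  by under eq_fun do rewrite big_nil; exact: Ck_cst.
by under eq_fun do rewrite big_cons; exact: CkM.
Qed.

Lemma Ck_mulmx (V : normedModType R) m n p k (D : set V)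
    (f : V -> 'M[R]_(m, n)) (g : V -> 'M[R]_(n, p)) :
  open D -> Ck k D f -> Ck k D g -> Ck k D (fun x => f x *m g x).
Proof.
move=> oD fC gC; apply: Ck_mx => // i j; under eq_fun do rewrite mxE.
by apply: Ck_sum => // l; apply: CkM => //; exact: Ck_entry.
Qed.

Lemma Ck_det (V : normedModType R) n k (D : set V) (f : V -> 'M[R]_n) :
  open D -> Ck k D f -> Ck k D (fun x => \det (f x)).
Proof.
move=> oD fC; apply: Ck_sum => // s; apply: CkM => //; first exact: Ck_cst.
by apply: Ck_prod => // i; exact: Ck_entry.
Qed.

(** Cramer's rule: the adjugate is polynomial in the entries, and the determinant can be inverted on
    [D]. *)
Lemma Ck_invmx (V : normedModType R) n k (D : set V) (f : V -> 'M[R]_n) :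
  open D -> (forall x, D x -> \det (f x) != 0) -> Ck k D f ->
  Ck k D (fun x => invmx (f x)).
Proof.
move=> oD f0 fC.
apply: (@Ck_eq _ _ _ _ _ (fun x => (\det (f x))^-1 *: \adj (f x))) => //.
  by move=> x Dx; rewrite /invmx unitmxE unitfE f0.
apply: Ck_mx => // i j; under eq_fun do rewrite !mxE.
apply: CkM => //; first by apply: CkV => //; exact: Ck_det.
apply: CkM => //; first exact: Ck_cst.
apply: Ck_det => //; apply: Ck_mx => // a b; under eq_fun do rewrite !mxE.
exact: Ck_entry.
Qed.

Lemma Ck_pair (U V W : normedModType R) k (D : set U) (f : U -> V) (g : U -> W) :
  open D -> Ck k D f -> Ck k D g -> Ck k D (fun x => (f x, g x)).
Proof.
move=> oD; elim: k f g => [|k IH] f g.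
  by move=> fc gc x Dx; apply: cvg_pair; [exact: fc|exact: gc].
move=> /CkS[df Df] /CkS[dg Dg]; split=> [x Dx|v].
  by apply: differentiable_pair; [exact: df|exact: dg].
apply: Ck_eq (IH _ _ (Df v) (Dg v)) => // x Dx.
by rewrite [RHS]derive_pair //; [exact: df|exact: dg].
Qed.

Lemma Ck_jac n k (D : set 'cV[R]_2) (f : 'cV[R]_2 -> 'cV[R]_n) :
  open D -> Ck k.+1 D f -> Ck k D (jac f).
Proof.
move=> oD fC; apply: Ck_mx => // i j; under eq_fun do rewrite mxE.
by have /CkS[_] := Ck_entry i 0 oD fC; exact.
Qed.

Lemma Ck_derive1 (W : normedModType R) k (D : set R) (f : R -> W) :
  Ck k.+1 D f -> Ck k D (derive1 f).
Proof.
move=> /CkS[_ /(_ 1)]; congr (Ck _ _); by apply/funext => x; rewrite derive1E.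
Qed.

Lemma derive_jac n (f : 'cV[R]_2 -> 'cV[R]_n) z h : differentiable f z ->
  'D_h f z = jac f z *m h.
Proof.
move=> df; rewrite (derive_coords (coords_col R 2)) //; apply/matrixP => i j.
rewrite ord1 summxE !mxE; apply: eq_bigr => l _.
by rewrite !mxE mulrC partial_coord.
Qed.

Lemma derive_real (W : normedModType R) (f : R -> W) (x v : R) :
  differentiable f x -> 'D_v f x = v *: derive1 f x.
Proof.
move=> df; rewrite derive1E !deriveE // -linearZ; congr ('d f x _).
by rewrite [RHS]mulr1.
Qed.

Lemma Ck_real (W : normedModType R) k (D : set R) (f : R -> W) : open D ->
  (forall x, D x -> differentiable f x) -> Ck k D (derive1 f) -> Ck k.+1 D f.
Proof.
move=> oD df Df; apply/CkS; split => // v.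
apply: (@Ck_eq _ _ _ _ _ (fun x => v *: derive1 f x)) => //.
  by move=> x Dx; rewrite derive_real //; exact: df.
by apply: (@Ck_linear_comp _ _ _ _ _ _ ( *:%R v)) => // x; exact: scaler_continuous.
Qed.

End CkMatrix.

(** * Existence of the local velocity field *)

Section FlowVelocity.
Context {R : realType}.
Variables (D : set 'cV[R]_2) (I : set R) (A : R -> 'M[R]_(2, 4)).
Variable v : 'cV[R]_2 -> 'cV[R]_4.
Hypotheses (oD : open D) (oI : open I) (AC : smooth_on I A) (vC : smooth_on D v).
Hypothesis P0 : forall z t, D z -> I t -> \det (A t *m jac v z) != 0.

Let V : completeNormedModType R := ('cV[R]_2 * R)%type.
Let E := [set q : V | D q.1 /\ I q.2].
Let cV : coords V := coords_prod (coords_col R 2) (coords_real R).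
Let F (q : V) : V := (flow A v q.1 q.2, q.2).
Let P (q : V) := A q.2 *m jac v q.1.
(** The differential of [F] is block triangular with diagonal blocks [P q] and 1, so its inverse is
    explicit. *)
Let H (q h : V) : V :=
  (invmx (P q) *m (h.1 - h.2 *: (derive1 A q.2 *m v q.1)), h.2).

Lemma open_E : open E.
Proof.
rewrite openE => -[z t] [/= Dz It]; exists (D, I) => /=; last by case.
by split; apply: open_nbhs_nbhs.
Qed.

Let CfstE (W : normedModType R) (d : coords W) k (f : 'cV[R]_2 -> W) :
  Ck k D f -> Ck k E (fun q : V => f q.1).
Proof.
apply: (@Ck_comp _ _ _ _ (coords_col R 2) d k E D fst f open_E oD) => [q []//|].
by apply: (@Ck_linear R V 'cV[R]_2 k E fst) => x; exact: cvg_fst.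
Qed.

Let CsndE (W : normedModType R) (d : coords W) k (f : R -> W) :
  Ck k I f -> Ck k E (fun q : V => f q.2).
Proof.
apply: (@Ck_comp _ _ _ _ (coords_real R) d k E I snd f open_E oI) => [q []//|].
by apply: (@Ck_linear R V R k E snd) => x; exact: cvg_snd.
Qed.

Lemma Ck_flow k : Ck k E (fun q : V => flow A v q.1 q.2).
Proof.
apply: Ck_mulmx; first exact: open_E.
  by apply: CsndE; [exact: coords_mx|exact: AC].
by apply: CfstE; [exact: coords_mx|exact: vC].
Qed.

(** The inverse function theorem is applied in space-time, to [(z, t) |-> (flow A v z t, t)],
    because the velocity has to be smooth jointly in position and time. *)
Lemma flow_local_velocity z0 t0 : D z0 -> I t0 ->
  exists W J u, [/\ W z0, J t0 & local_velocity D I (flow A v) W J u].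
Proof.
move=> Dz0 It0; have oE := open_E.
have FC k : Ck k E F.
  apply: Ck_pair => //; first exact: Ck_flow.
  by apply: (@Ck_linear R V R k E snd) => x; exact: cvg_snd.
have AE z t : I t -> differentiable A t by have /CkS[dA _] := AC 1; exact: dA.
have vE z : D z -> differentiable v z by have /CkS[dv _] := vC 1; exact: dv.
have dF q h : E q -> 'D_h F q = (P q *m h.1 + h.2 *: (derive1 A q.2 *m v q.1), h.2).
  case: q h => [z t] [h s] [/= Dz It].
  have df : differentiable (fun q : V => flow A v q.1 q.2) (z, t).
    by have /CkS[dfl _] := Ck_flow 1; exact: dfl.
  rewrite derive_pair //; last first.
    by apply: (@linear_differentiable _ V R snd) => x; exact: cvg_snd.
  congr pair; last first.
    by apply: (@derive_linear _ V R snd) => x; exact: cvg_snd.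
  have -> : (h, s) = (h, 0) + s *: (0, 1) :> V.
    by congr pair; rewrite /= ?scaler0 ?addr0 // add0r [_ *: _]mulr1.
  rewrite deriveE // linearD linearZ -!deriveE // -derive_slicel -derive_slicer.
  rewrite -derive1E /flow derive1_mulmx; last exact: AE.
  rewrite derive_jac; last by apply: differentiable_mulmx; exact: vE.
  by rewrite jac_mulmx //; exact: vE.
have uP q : E q -> P q \in unitmx by move=> [Dq Iq]; rewrite unitmxE unitfE P0.
have HK q h : E q -> H q ('D_h F q) = h.
  by move=> Eq; rewrite dF // /H /= addrK mulKmx ?uP //; case: h.
have KH q h : E q -> 'D_(H q h) F q = h.
  by move=> Eq; rewrite dF // /H /= mulKVmx ?uP // subrK; case: h.
have HC h k : Ck k E (H^~ h).
  apply: Ck_pair => //; last exact: Ck_cst.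
  apply: Ck_mulmx => //.
    apply: Ck_invmx => // [q [Dq Iq]|]; first exact: P0.
    apply: Ck_mulmx => //; first by apply: CsndE; [exact: coords_mx|exact: AC].
    by apply: CfstE; [exact: coords_mx|exact/Ck_jac/vC].
  apply: CkB => //; first exact: Ck_cst.
  apply: (@Ck_linear_comp _ _ _ _ _ _ ( *:%R h.2)) => //.
    by move=> x; exact: scaler_continuous.
  apply: Ck_mulmx => //.
    by apply: CsndE; [exact: coords_mx|exact/Ck_derive1/AC].
  by apply: CfstE; [exact: coords_mx|exact: vC].
have [r [g [r0 rE opF gF gC]]] :=
  @inverse_function R V cV E F H oE (FC 1%N) HK KH (z0, t0) (conj Dz0 It0) HC.
pose W := ball z0 r; pose J := ball t0 r.
(* A ball of the product is a product of balls, so its image is a swept region. *)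
have bWJ q : ball ((z0, t0) : V) r q <-> W q.1 /\ J q.2 by [].
have sw : swept (flow A v) W J = F @` ball ((z0, t0) : V) r.
  apply/seteqP; split=> [[x t] [z Wz [/= Jt ->]]|_ [[z t] /bWJ[/= Wz Jt] <-]].
    by exists (z, t) => //; apply/bWJ.
  by exists z.
pose u x t := derive1 A (g (x, t)).2 *m v (g (x, t)).1.
exists W, J, u; split; [exact: ballxx|exact: ballxx|].
have oB : open (F @` ball ((z0, t0) : V) r) by apply: opF => //; exact: ball_open.
split.
- split; first exact: ball_open.
  by move=> z Wz; have [|//] := rE (z, t0); apply/bWJ; split => //; exact: ballxx.
- split; first exact: ball_open.
  by move=> t Jt; have [|//] := rE (z0, t); apply/bWJ; split => //; exact: ballxx.
- by rewrite sw.
- move=> k; rewrite sw (_ : (fun q => u q.1 q.2) =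
      fun q => derive1 A (g q).2 *m v (g q).1); last first.
    by apply/funext => -[].
  apply: (@Ck_comp _ _ _ _ cV (coords_col R 2) k _ E g
    (fun q => derive1 A q.2 *m v q.1)) => //.
  + by move=> _ [q bq <-]; rewrite gF //; exact: rE.
  apply: Ck_mulmx => //.
    by apply: CsndE; [exact: coords_mx|exact/Ck_derive1/AC].
  by apply: CfstE; [exact: coords_mx|exact: vC].
- move=> z t Wz Jt; have bq : ball ((z0, t0) : V) r (z, t) by apply/bWJ.
  have [/= Dz It] := rE _ bq.
  by rewrite /u -[(flow A v z t, t)]/(F (z, t)) gF //= derive1_mulmx //; exact: AE.
Qed.

End FlowVelocity.

(** * Planar linear algebra *)

Section Coordinates2.
Context {R : realType}.

Lemma sum2 (V : nmodType) (F : 'I_2 -> V) : \sum_(i < 2) F i = F 0 + F 1.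
Proof. by rewrite !big_ord_recl big_ord0 addr0; congr (_ + F _); apply: val_inj. Qed.

Lemma sum4 (V : nmodType) (F : 'I_4 -> V) :
  \sum_(i < 4) F i = F 0 + F 1 + F 2 + F 3.
Proof.
rewrite !big_ord_recl big_ord0 addr0 !addrA.
by congr (_ + F _ + F _ + F _); apply: val_inj.
Qed.

Lemma det2 (N : 'M[R]_2) : \det N = N 0 0 * N 1 1 - N 0 1 * N 1 0.
Proof.
rewrite (expand_det_row _ 0) sum2 /cofactor !det_mx11 !mxE /=.
have E a : lift (0 : 'I_2) a = 1 by apply: val_inj; case: a => -[].
have E' a : lift (1 : 'I_2) a = 0 by apply: val_inj; case: a => -[].
by rewrite !E !E' /= expr0 expr1; ring.
Qed.

Lemma ord2P (P : 'I_2 -> Prop) : P 0 -> P 1 -> forall i, P i.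
Proof.
move=> P0 P1; case=> -[|[|//]] p; first by rewrite (_ : Ordinal p = 0) //; apply: val_inj.
by rewrite (_ : Ordinal p = 1) //; apply: val_inj.
Qed.

Lemma ord4P (P : 'I_4 -> Prop) : P 0 -> P 1 -> P 2 -> P 3 -> forall i, P i.
Proof.
move=> P0 P1 P2 P3; case=> -[|[|[|[|//]]]] p.
- by rewrite (_ : Ordinal p = 0) //; apply: val_inj.
- by rewrite (_ : Ordinal p = 1) //; apply: val_inj.
- by rewrite (_ : Ordinal p = 2) //; apply: val_inj.
- by rewrite (_ : Ordinal p = 3) //; apply: val_inj.
Qed.

(** Multiplying by the adjugate of [P] gives [\det P *: G = Q *m \adj P]; the right-hand side is the
    trace. The next lemma takes the antisymmetric part instead. *)
Lemma trace_quotient (G P Q : 'M[R]_2) : G *m P = Q ->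
  \tr G * \det P = Q 0 0 * P 1 1 - Q 0 1 * P 1 0 - Q 1 0 * P 0 1 + Q 1 1 * P 0 0.
Proof. by move=> <-; rewrite det2 /mxtrace sum2 !mxE !sum2; ring. Qed.

Lemma curl_quotient (G P Q : 'M[R]_2) : G *m P = Q ->
  (G 1 0 - G 0 1) * \det P =
  Q 1 0 * P 1 1 - Q 1 1 * P 1 0 + Q 0 0 * P 0 1 - Q 0 1 * P 0 0.
Proof. by move=> <-; rewrite det2 !mxE !sum2; ring. Qed.

Lemma divergenceE (u : 'cV[R]_2 -> 'cV[R]_2) x : divergence u x = \tr (jac u x).
Proof. by apply: eq_bigr => i _; rewrite mxE. Qed.

Lemma vorticityE (u : 'cV[R]_2 -> 'cV[R]_2) x :
  vorticity u x = jac u x 1 0 - jac u x 0 1.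
Proof. by rewrite !mxE. Qed.

Lemma derive_coordinate (i j : 'I_2) (z : 'cV[R]_2) :
  'D_(delta_mx j 0) (fun w : 'cV[R]_2 => w i 0) z = (i == j)%:R.
Proof.
have := @derive_linear R 'cV[R]_2 R (mx_coord i 0) z (delta_mx j 0)
  (@mx_coord_continuous R 2 1 i 0).
by rewrite [RHS]mxE eqxx andbT.
Qed.

Lemma derive_sqnorm (j : 'I_2) (y : 'cV[R]_2) :
  'D_(delta_mx j 0) (fun x : 'cV[R]_2 => x 0 0 * x 0 0 + x 1 0 * x 1 0) y = 2 * y j 0.
Proof.
have cd i : derivable (fun w : 'cV[R]_2 => w i 0) y (delta_mx j 0).
  apply: diff_derivable; apply: (@linear_differentiable _ _ _ (mx_coord i 0)).
  exact: mx_coord_continuous.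
have c2 i := derivableM (cd i) (cd i).
rewrite (deriveD (c2 0) (c2 1)) (deriveM (cd 0) (cd 0)) (deriveM (cd 1) (cd 1)).
rewrite !derive_coordinate /GRing.scale /=.
by elim/ord2P: j {cd c2} => /=; ring.
Qed.

End Coordinates2.

(** * Part (i): the explicit solution *)

Section ExplicitSolution.
Context {R : realType}.
Variable c : R.

Let N1 : 'M[R]_(2, 4) := delta_mx 0 0 + delta_mx 1 2.
Let N2 : 'M[R]_(2, 4) := delta_mx 0 3 + delta_mx 1 1.
(** A family containing [Ac c] and closed under differentiation, which only multiplies [a] by [c]
    and [b] by [- c]. Smoothness then follows by induction for all members at once. *)
Let B (a b t : R) := (a * expR (c * t)) *: N1 + (b * expR (- c * t)) *: N2.

Lemma AcE : Ac c = B 1 1.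
Proof.
apply/funext => t; apply/matrixP => i j; rewrite /B mulNr.
by elim/ord2P: i; elim/ord4P: j; rewrite !mxE /=; ring.
Qed.

Lemma derive_expRM (a k t : R) :
  differentiable (fun s => a * expR (k * s)) t /\
  'D_1 (fun s => a * expR (k * s)) t = a * k * expR (k * t).
Proof.
have dk : differentiable (fun s : R => k * s) t by apply: differentiableM.
have de : differentiable (@expR R) (k * t).
  by apply/derivable1_diffP; exact: ex_derive.
have dke : differentiable (fun s => expR (k * s)) t by exact: differentiable_comp.
split; first by apply: differentiableM.
rewrite deriveMl; last exact: diff_derivable.
rewrite derive_comp // deriveMl // derive_id derive_real // derive1E derive_val.
by rewrite mulr1 /GRing.scale /= mulrA.
Qed.

Lemma differentiable_B a b t : differentiable (B a b) t.
Proof.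
have [d1 _] := derive_expRM a c t; have [d2 _] := derive_expRM b (- c) t.
by apply: differentiableD; apply: (differentiable_linear_comp (L := scale_vec _)) => //;
   exact: scale_vec_continuous.
Qed.

Lemma derive1_B a b : derive1 (B a b) = B (a * c) (b * - c).
Proof.
apply/funext => t; rewrite derive1E.
have [d1 e1] := derive_expRM a c t; have [d2 e2] := derive_expRM b (- c) t.
have s1 := @scale_vec_continuous R _ N1; have s2 := @scale_vec_continuous R _ N2.
rewrite deriveD.
- rewrite (derive_linear_comp (L := scale_vec N1)) // e1.
  by rewrite (derive_linear_comp (L := scale_vec N2)) // e2.
- by apply: diff_derivable; exact: (differentiable_linear_comp (L := scale_vec N1)).
- by apply: diff_derivable; exact: (differentiable_linear_comp (L := scale_vec N2)).
Qed.

Lemma derive1_Ac t : derive1 (Ac c) t = \matrix_(i < 2, j < 4)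
  nth 0 (nth [::]
      [:: [:: c * expR (c * t); 0; 0; - (c * expR (- (c * t)))];
          [:: 0; - (c * expR (- (c * t))); c * expR (c * t); 0]] i) j.
Proof.
rewrite AcE derive1_B; apply/matrixP => i j; rewrite /B mulNr.
by elim/ord2P: i; elim/ord4P: j; rewrite !mxE /=; ring.
Qed.

Lemma derive1_derive1_Ac t : derive1 (derive1 (Ac c)) t = c ^+ 2 *: Ac c t.
Proof.
rewrite AcE !derive1_B /B; apply/matrixP => i j; rewrite !mxE; ring.
Qed.

Lemma smooth_Ac : smooth_on setT (Ac c).
Proof.
have CB a b k : Ck k setT (B a b).
  elim: k a b => [|k IH] a b.
    by move=> t _; exact/differentiable_continuous/differentiable_B.
  apply: Ck_real; [exact: openT|by move=> t _; exact: differentiable_B|].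
  by rewrite derive1_B.
by move=> k; rewrite AcE.
Qed.

Variables (D : set 'cV[R]_2) (J1 J2 : set R) (f1 f2 : R -> R).
Hypothesis oD : open D.
Hypotheses (C1 : smooth_on J1 f1) (C2 : smooth_on J2 f2).
Hypothesis DJ : forall z, D z -> J1 (z 0 0) /\ J2 (z 1 0).

Let Ccoord k i : Ck k D (fun z : 'cV[R]_2 => z i 0).
Proof. by apply: (@Ck_linear _ _ _ _ _ (mx_coord i 0)); exact: mx_coord_continuous. Qed.

Lemma smooth_graph_vec : smooth_on D (graph_vec f1 f2).
Proof.
move=> k; apply: Ck_mx => // i j; elim/ord4P: i; under eq_fun do rewrite mxE /=.
- exact: Ccoord.
- exact: Ccoord.
- apply: (@Ck_comp_real _ _ _ (coords_real R) k D J1 (fun z => z 0 0) f1) => //.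
  by move=> z /DJ[].
- apply: (@Ck_comp_real _ _ _ (coords_real R) k D J2 (fun z => z 1 0) f2) => //.
  by move=> z /DJ[].
Qed.

Lemma jac_graph_vec z : D z -> jac (graph_vec f1 f2) z =
  \matrix_(i < 4, j < 2) nth 0 (nth [::]
    [:: [:: 1; 0]; [:: 0; 1]; [:: derive1 f1 (z 0 0); 0]; [:: 0; derive1 f2 (z 1 0)]] i) j.
Proof.
move=> Dz; have [J1z J2z] := DJ Dz.
have d1 : differentiable f1 (z 0 0) by have /CkS[df _] := C1 1; exact: df.
have d2 : differentiable f2 (z 1 0) by have /CkS[df _] := C2 1; exact: df.
have dc i j := derive_coordinate i j z.
have cd i : differentiable (fun w : 'cV[R]_2 => w i 0) z.
  by have /CkS[df _] := Ccoord 1 i; exact: df.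
apply/matrixP => i j; rewrite !mxE /partial; elim/ord4P: i.
- rewrite (_ : (fun w => graph_vec f1 f2 w 0 0) = fun w => w 0 0); last first.
    by apply/funext => w; rewrite mxE.
  by rewrite dc; elim/ord2P: j.
- rewrite (_ : (fun w => graph_vec f1 f2 w 1 0) = fun w => w 1 0); last first.
    by apply/funext => w; rewrite mxE.
  by rewrite dc; elim/ord2P: j.
- rewrite (_ : (fun w => graph_vec f1 f2 w 2 0) = fun w => f1 (w 0 0)); last first.
    by apply/funext => w; rewrite mxE.
  rewrite derive_comp // dc derive_real // /GRing.scale /=.
  by elim/ord2P: j => /=; rewrite ?mul1r ?mul0r.
- rewrite (_ : (fun w => graph_vec f1 f2 w 3 0) = fun w => f2 (w 1 0)); last first.
    by apply/funext => w; rewrite mxE.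
  rewrite derive_comp // dc derive_real // /GRing.scale /=.
  by elim/ord2P: j => /=; rewrite ?mul1r ?mul0r.
Qed.

Let expK t : expR (c * t) * expR (- (c * t)) = 1.
Proof. by rewrite -expRD subrr expR0. Qed.

(** The coefficients of [exp (2 c t)] and [exp (- 2 c t)] are the minors (1, 3) and (2, 4) of the
    graph, which vanish; elsewhere the exponentials multiply to 1. *)
Lemma det_jac_graph t z : D z ->
  \det (Ac c t *m jac (graph_vec f1 f2) z) = 1 - derive1 f1 (z 0 0) * derive1 f2 (z 1 0).
Proof.
move=> Dz; rewrite jac_graph_vec // det2 !mxE !sum4 !mxE /=.
by have := expK t; move: (expR _) (expR _) => a b ab; ring: ab.
Qed.

Hypothesis P0 : forall z, D z -> 1 - derive1 f1 (z 0 0) * derive1 f2 (z 1 0) != 0.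

Section Vel.
Variables (W : set 'cV[R]_2) (J : set R) (u : 'cV[R]_2 -> R -> 'cV[R]_2).
Hypothesis uP : local_velocity D setT (flow (Ac c) (graph_vec f1 f2)) W J u.

(** Antisymmetric part of [velocity_jac]. The sign is plus for the convention of [vorticity],
    opposite to the sign in the formula for zeta stated at the top. *)
Lemma explicit_vorticity z t : W z -> J t ->
  vorticity (u^~ t) (flow (Ac c) (graph_vec f1 f2) z t) =
  2 * c * (derive1 f1 (z 0 0) + derive1 f2 (z 1 0)) /
    (1 - derive1 f1 (z 0 0) * derive1 f2 (z 1 0)).
Proof.
move=> Wz Jt; have Dz : D z by have [[_ WD] _ _ _ _] := uP; exact: WD.
have := velocity_jac (smooth_Ac 2) (smooth_graph_vec 1) uP Wz Jt.
move=> /curl_quotient; rewrite det_jac_graph // -vorticityE => E.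
apply: (mulIf (P0 Dz)); rewrite E divfK ?P0 //.
rewrite jac_graph_vec // derive1_Ac !mxE !sum4 !mxE /=.
by have := expK t; move: (expR _) (expR _) => a b ab; ring: ab.
Qed.

Lemma explicit_divergence z t : W z -> J t ->
  divergence (u^~ t) (flow (Ac c) (graph_vec f1 f2) z t) = 0.
Proof.
move=> Wz Jt; have Dz : D z by have [[_ WD] _ _ _ _] := uP; exact: WD.
have := velocity_jac (smooth_Ac 2) (smooth_graph_vec 1) uP Wz Jt.
move=> /trace_quotient; rewrite det_jac_graph // -divergenceE => E.
apply: (mulIf (P0 Dz)); rewrite E mul0r.
rewrite jac_graph_vec // derive1_Ac !mxE !sum4 !mxE /=.
by have := expK t; move: (expR _) (expR _) => a b ab; ring: ab.
Qed.

Lemma explicit_euler : exists p, euler_on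
  (swept (flow (Ac c) (graph_vec f1 f2)) W J) u p.
Proof.
have [_ _ oS uC _] := uP.
pose p (x : 'cV[R]_2) (t : R) := - (c ^+ 2 / 2) * (x 0 0 * x 0 0 + x 1 0 * x 1 0).
exists p; split => //.
  move=> k; have Cc i : Ck k (swept (flow (Ac c) (graph_vec f1 f2)) W J)
      (fun q : 'cV[R]_2 * R => q.1 i 0).
    apply: (@Ck_linear_comp _ _ _ _ _ _ (mx_coord i 0) fst) => //.
      exact: mx_coord_continuous.
    by apply: (@Ck_linear R ('cV[R]_2 * R)%type 'cV[R]_2 k _ fst) => x; exact: cvg_fst.
  by apply: CkM => //; [exact: Ck_cst|apply: CkD => //; exact: CkM].
move=> x t [z Wz [/= Jt ->]]; split; last exact: explicit_divergence.
rewrite (velocity_acc (smooth_Ac 2) uP) //.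
rewrite derive1_derive1_Ac -scalemxAl.
(* Only the position matters from here on: the acceleration is [c ^+ 2 *: y]. *)
set y := flow _ _ z t; rewrite -[_ *m _]/y; move: y => y.
apply/matrixP => j j0; rewrite ord1 !mxE /partial /p deriveMl; last first.
  have cd i : derivable (fun w : 'cV[R]_2 => w i 0) y (delta_mx j 0).
    apply: diff_derivable; apply: (@linear_differentiable _ _ _ (mx_coord i 0)).
    exact: mx_coord_continuous.
  exact: (derivableD (derivableM (cd 0) (cd 0)) (derivableM (cd 1) (cd 1))).
by rewrite derive_sqnorm /GRing.scale /=; field.
Qed.

End Vel.

Lemma explicit_gives_euler :
  gives_euler_solution D setT (flow (Ac c) (graph_vec f1 f2)).
Proof.
move=> z0 t0 Dz0 _.
have [|W [J [u [Wz Jt uP]]]] := flow_local_velocity oD openT smooth_Ac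
  smooth_graph_vec _ Dz0 (I : setT t0).
  by move=> z t Dz _; rewrite det_jac_graph // P0.
have [p pP] := explicit_euler uP.
by exists W, J, u, p.
Qed.

End ExplicitSolution.

(** * Planar curves with constant mutual determinants *)

(** The derivative is an argument, so that chaining the rules below computes it along with the
    proof. *)
Definition der (R : realType) (I : set R) (f f' : R -> R) :=
  forall t : R, I t -> is_derive t (1 : R) f (f' t).

Section Der.
Context {R : realType} (I : set R).
Implicit Types f g : R -> R.

Lemma derM f f' g g' : der I f f' -> der I g g' ->
  der I (fun t => f t * g t) (fun t => f' t * g t + f t * g' t).
Proof.
move=> df dg t It; apply: is_derive_eq; first exact: (is_deriveM (df t It) (dg t It)).
by rewrite /GRing.scale /= addrC; congr (_ + _); rewrite mulrC.
Qed.

Lemma derD f f' g g' : der I f f' -> der I g g' ->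
  der I (fun t => f t + g t) (fun t => f' t + g' t).
Proof. by move=> df dg t It; exact: (is_deriveD (df t It) (dg t It)). Qed.

Lemma derB f f' g g' : der I f f' -> der I g g' ->
  der I (fun t => f t - g t) (fun t => f' t - g' t).
Proof. by move=> df dg t It; exact: (is_deriveB (df t It) (dg t It)). Qed.

Lemma derC (a : R) : der I (fun=> a) (fun=> 0).
Proof. by move=> t It; exact: is_derive_cst. Qed.

Lemma derZ (a : R) f f' : der I f f' -> der I (fun t => a * f t) (fun t => a * f' t).
Proof.
move=> df t It; have := derM (derC a) df It.
by rewrite mul0r add0r.
Qed.

Lemma derV f f' : (forall t, I t -> f t != 0) -> der I f f' ->
  der I (fun t => (f t)^-1) (fun t => - (f t) ^- 2 * f' t).
Proof. by move=> f0 df t It; exact: (is_deriveV (f0 t It) (df t It)). Qed.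

Lemma der_ext f f' g' : (forall t, I t -> f' t = g' t) -> der I f f' -> der I f g'.
Proof. by move=> fg df t It; rewrite -fg //; exact: df. Qed.

Lemma der_lin (a : R) : der I (fun t => a * t) (fun=> a).
Proof.
move=> t It; have := derZ a (f := fun t => t) (f' := fun=> 1) _ It.
by rewrite mulr1; apply => s _; exact: is_derive_id.
Qed.

Lemma der_exp (a : R) : der I (fun t => expR (a * t)) (fun t => a * expR (a * t)).
Proof.
move=> t It; have d1 := der_lin a It.
have H := is_derive1_comp (is_derive_expR (a * t)) d1.
change (is_derive t (1 : R) (expR \o (fun s => a * s)) (a * expR (a * t))); apply: (is_derive_eq H).
by rewrite mulrC.
Qed.

Lemma der_cos (a : R) : der I (fun t => cos (a * t)) (fun t => - a * sin (a * t)).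
Proof.
move=> t It; have d1 := der_lin a It.
have H := is_derive1_comp (is_derive_cos (a * t)) d1.
change (is_derive t (1 : R) (cos \o (fun s => a * s)) (- a * sin (a * t))); apply: (is_derive_eq H).
by ring.
Qed.

Lemma der_sin (a : R) : der I (fun t => sin (a * t)) (fun t => a * cos (a * t)).
Proof.
move=> t It; have d1 := der_lin a It.
have H := is_derive1_comp (is_derive_sin (a * t)) d1.
change (is_derive t (1 : R) (sin \o (fun s => a * s)) (a * cos (a * t))); apply: (is_derive_eq H).
by ring.
Qed.

Hypothesis HI : open_interval I.

(** The means by which identities valid on [I] are differentiated. *)
Lemma der_unique f f' g g' : der I f f' -> der I g g' ->
  (forall t, I t -> f t = g t) -> forall t, I t -> f' t = g' t.
Proof.
move=> df dg fg t It; have [_ oI _] := HI.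
have <- := @derive_val _ _ _ _ _ _ _ (df t It).
have <- := @derive_val _ _ _ _ _ _ _ (dg t It).
apply: near_eq_derive; near=> s; apply: fg; near: s; exact: open_nbhs_nbhs.
Unshelve. all: by end_near. Qed.

Lemma der0_const f : der I f (fun=> 0) -> forall s t, I s -> I t -> f s = f t.
Proof.
move=> df; have [_ _ II] := HI.
suff H s t : I s -> I t -> s < t -> f s = f t.
  move=> s t Is It; case: (ltgtP s t) => [|/H->//|->//]; exact: H.
move=> Is It st; have [||x _] := @MVT R f (fun=> 0) s t st.
- by move=> x; rewrite in_itv /= => /andP[sx xt]; apply: df; apply: (II s t) => //; rewrite !ltW.
- apply: continuous_in_subspaceT => x; rewrite inE /= in_itv /= => /andP[sx xt].
  have dfx := df x (II s t Is It x _).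
  apply: differentiable_continuous; apply/derivable1_diffP; apply: ex_derive.
  by apply: dfx; rewrite sx.
by rewrite mul0r => /eqP; rewrite subr_eq0 => /eqP.
Qed.

End Der.

(* The letters p, q, r, s stand for the columns 1, 2, 3, 4. *)
Section SingularPairing.
Context {R : realType} (I : set R) (HI : open_interval I).
Variables (px py qx qy rx ry sx sy px' py' qx' qy' rx' ry' sx' sy' : R -> R).
Hypotheses (dpx : der I px px') (dpy : der I py py') (dqx : der I qx qx')
  (dqy : der I qy qy') (drx : der I rx rx') (dry : der I ry ry')
  (dsx : der I sx sx') (dsy : der I sy sy').
Variables (kpq kps krq krs lpq lps : R).
Hypothesis Kpq : forall t, I t -> px t * qy t - py t * qx t = kpq.
Hypothesis Kps : forall t, I t -> px t * sy t - py t * sx t = kps.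
Hypothesis Krq : forall t, I t -> rx t * qy t - ry t * qx t = krq.
Hypothesis Krs : forall t, I t -> rx t * sy t - ry t * sx t = krs.
Hypothesis Lpq : forall t, I t ->
  px' t * qx t + py' t * qy t - px t * qx' t - py t * qy' t = lpq.
Hypothesis Lps : forall t, I t ->
  px' t * sx t + py' t * sy t - px t * sx' t - py t * sy' t = lps.

(** The matrix of determinants has rank one, which forces [mu nu = 0] for the corrections below. The
    second family of constants makes [mu' |p|^2] constant. If it is zero, [mu] is constant and [s]
    is a combination of [q] and [p]; otherwise [mu'] never vanishes, so [nu] is zero and [r] is a
    multiple of [p]. *)
Lemma singular_dependent : kpq != 0 -> kpq * krs = kps * krq ->
  (exists a, forall t, I t -> rx t = a * px t /\ ry t = a * py t) \/
  (exists a b, forall t, I t -> sx t = a * qx t + b * px t /\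
                                sy t = a * qy t + b * py t).
Proof.
move=> k0 det0; pose m := krq / kpq; pose n := kps / kpq.
have mE : m * kpq = krq by rewrite divfK.
have nE : n * kpq = kps by rewrite divfK.
have kE : krs = m * n * kpq.
  by apply: (mulfI k0); rewrite det0 -mE -nE; ring.
pose bx t := rx t - m * px t; pose by_ t := ry t - m * py t.
pose dx t := sx t - n * qx t; pose dy t := sy t - n * qy t.
pose nu t := kpq^-1 * (px t * by_ t - py t * bx t).
pose mu t := kpq^-1 * (dx t * qy t - dy t * qx t).
have dbx : der I bx (fun t => rx' t - m * px' t)
  by exact: (derB drx (derZ _ dpx)).
have dby : der I by_ (fun t => ry' t - m * py' t)
  by exact: (derB dry (derZ _ dpy)).
have ddx : der I dx (fun t => sx' t - n * qx' t)
  by exact: (derB dsx (derZ _ dqx)).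
have ddy : der I dy (fun t => sy' t - n * qy' t)
  by exact: (derB dsy (derZ _ dqy)).
have [nu' dnu] : exists nu', der I nu nu'.
  by eexists; apply: derZ; apply: derB; apply: derM; eassumption.
have [mu' dmu] : exists mu', der I mu mu'.
  by eexists; apply: derZ; apply: derB; apply: derM; eassumption.
have bq t : I t -> bx t * qy t - by_ t * qx t = 0.
  move=> It; rewrite /bx /by_; have := Krq It; have := Kpq It => h1 h2.
  by rewrite -mE -h1 in h2; lra.
have pd t : I t -> px t * dy t - py t * dx t = 0.
  move=> It; rewrite /dx /dy; have := Kps It; have := Kpq It => h1 h2.
  by rewrite -nE -h1 in h2; lra.
have bE t : I t -> bx t = nu t * qx t /\ by_ t = nu t * qy t.
  move=> It; have h := bq t It; have h1 := Kpq It; rewrite /nu.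
  by split; apply: (mulfI k0); rewrite -mulrA mulVKf // -h1;
    [have := congr1 ( *%R (px t)) h|have := congr1 ( *%R (py t)) h]; lra.
have dE t : I t -> dx t = mu t * px t /\ dy t = mu t * py t.
  move=> It; have h := pd t It; have h1 := Kpq It; rewrite /mu.
  by split; apply: (mulfI k0); rewrite -mulrA mulVKf // -h1;
    [have := congr1 ( *%R (qx t)) h|have := congr1 ( *%R (qy t)) h]; lra.
(* [r] and [s], corrected by multiples of [p] and [q], are [nu q] and [mu p]. *)
have munu t : I t -> mu t * nu t = 0.
  move=> It; have [b1 b2] := bE t It; have [d1 d2] := dE t It.
  have h : bx t * dy t - by_ t * dx t = 0.
    have := Krs It; have := Kps It; have := Krq It; have := Kpq It.
    rewrite kE -mE -nE /bx /by_ /dx /dy => h1 h2 h3 h4.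
    have := congr1 ( *%R m) h3; have := congr1 ( *%R n) h2; have := congr1 ( *%R (m * n)) h1; lra.
  rewrite b1 b2 d1 d2 in h; apply: (mulfI k0); rewrite mulr0 -(Kpq It); lra.
have p0 t : I t -> px t * px t + py t * py t != 0.
  move=> It; apply/negP => /eqP h.
  have [x0 y0] : px t = 0 /\ py t = 0.
    have hx : 0 <= px t * px t by rewrite -expr2 sqr_ge0.
    have hy : 0 <= py t * py t by rewrite -expr2 sqr_ge0.
    by split; apply/eqP; rewrite -sqrf_eq0 expr2; apply/eqP; lra.
  by have := Kpq It; rewrite x0 y0 !mul0r subrr => /esym/eqP; rewrite (negPf k0).
have d'x := der_unique HI ddx (derM dmu dpx) (fun t It => (dE t It).1).
have d'y := der_unique HI ddy (derM dmu dpy) (fun t It => (dE t It).2).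
(* In [p' . (mu p) - p . (mu p)'] the terms containing [p'] cancel. *)
have Lpd t : I t -> mu' t * (px t * px t + py t * py t) = n * lpq - lps.
  move=> It; have := d'x t It; have := d'y t It; have [] := dE t It.
  rewrite /dx /dy => e1 e2 e3 e4; rewrite -(Lpq It) -(Lps It).
  have := congr1 ( *%R (px t)) e4; have := congr1 ( *%R (py t)) e3.
  have := congr1 ( *%R (px' t)) e1; have := congr1 ( *%R (py' t)) e2; lra.
have mn' t : I t -> mu' t * nu t + mu t * nu' t = 0.
  have h := der_unique HI (derM dmu dnu) (derC (0 : R)).
  by move=> It; exact: (h munu t It).
have [t0 It0] : I !=set0 by case: HI.
have [C0|C0] := eqVneq (n * lpq - lps) 0.
  right; exists n, (mu t0) => t It.
  have muc : mu t = mu t0.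
    have mu0 : der I mu (fun=> 0).
      apply: der_ext dmu => s Is.
      by apply: (mulIf (p0 s Is)); rewrite Lpd // C0 mul0r.
    exact: (der0_const HI mu0).
  by have [] := dE t It; rewrite muc /dx /dy => h1 h2; split; lra.
left; exists m => t It.
have nu0 : nu t = 0.
  have mu0 : mu' t != 0.
    by apply: contra_neq C0 => h; rewrite -(Lpd t It) h mul0r.
  (* Multiplying [(mu nu)' = 0] by [nu] and using [mu nu = 0] leaves [mu' nu^2 = 0]. *)
  apply/eqP; rewrite -sqrf_eq0; apply/eqP; apply: (mulfI mu0).
  have := congr1 ( *%R (nu t)) (mn' t It); have := congr1 ( *%R (nu' t)) (munu t It); lra.
by have [] := bE t It; rewrite nu0 /bx /by_ !mul0r => h1 h2; split; lra.
Qed.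

End SingularPairing.

(** * Curves whose matrix of mutual determinants is invertible *)

Section RegularPairing.
Context {R : realType} (I : set R) (HI : open_interval I).
Variables (px py qx qy rx ry sx sy px' py' qx' qy' rx' ry' sx' sy' : R -> R).
Hypotheses (dpx : der I px px') (dpy : der I py py') (dqx : der I qx qx')
  (dqy : der I qy qy') (drx : der I rx rx') (dry : der I ry ry')
  (dsx : der I sx sx') (dsy : der I sy sy').
Variables (kpq kps krq krs lpq lps lrq lrs : R).
Hypothesis Kpq : forall t, I t -> px t * qy t - py t * qx t = kpq.
Hypothesis Kps : forall t, I t -> px t * sy t - py t * sx t = kps.
Hypothesis Krq : forall t, I t -> rx t * qy t - ry t * qx t = krq.
Hypothesis Krs : forall t, I t -> rx t * sy t - ry t * sx t = krs.
Hypothesis Lpq : forall t, I t ->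
  px' t * qx t + py' t * qy t - px t * qx' t - py t * qy' t = lpq.
Hypothesis Lps : forall t, I t ->
  px' t * sx t + py' t * sy t - px t * sx' t - py t * sy' t = lps.
Hypothesis Lrq : forall t, I t ->
  rx' t * qx t + ry' t * qy t - rx t * qx' t - ry t * qy' t = lrq.
Hypothesis Lrs : forall t, I t ->
  rx' t * sx t + ry' t * sy t - rx t * sx' t - ry t * sy' t = lrs.
Let De := kpq * krs - kps * krq.
Hypothesis De0 : De != 0.

Let d t := px t * ry t - py t * rx t.
Let d' t := px' t * ry t + px t * ry' t - (py' t * rx t + py t * rx' t).
Let dd : der I d d'. Proof. by apply: derB; exact: derM. Qed.

(** The matrix of mutual determinants is the transpose of [(p, r)], times a quarter turn, times
    [(q, s)]; take determinants. *)
Let dP t : I t -> d t * (qx t * sy t - qy t * sx t) = De.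
Proof. by move=> It; rewrite /De /d -(Kpq It) -(Kps It) -(Krq It) -(Krs It); ring. Qed.

Let d0 t : I t -> d t != 0.
Proof. by move=> It; apply: contra_neq De0 => h; rewrite -(dP It) h mul0r. Qed.

(* [e = p / d] and [f = r / d], written as constant combinations of [q], [s]. *)
Let ex t := De^-1 * (kps * qx t - kpq * sx t).
Let ey t := De^-1 * (kps * qy t - kpq * sy t).
Let fx t := De^-1 * (krs * qx t - krq * sx t).
Let fy t := De^-1 * (krs * qy t - krq * sy t).
Let ex' t := De^-1 * (kps * qx' t - kpq * sx' t).
Let ey' t := De^-1 * (kps * qy' t - kpq * sy' t).
Let fx' t := De^-1 * (krs * qx' t - krq * sx' t).
Let fy' t := De^-1 * (krs * qy' t - krq * sy' t).
Let dex : der I ex ex'. Proof. by apply: derZ; apply: derB; exact: derZ. Qed.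
Let dey : der I ey ey'. Proof. by apply: derZ; apply: derB; exact: derZ. Qed.
Let dfx : der I fx fx'. Proof. by apply: derZ; apply: derB; exact: derZ. Qed.
Let dfy : der I fy fy'. Proof. by apply: derZ; apply: derB; exact: derZ. Qed.

Let exE t : I t -> d t * ex t = px t.
Proof.
move=> It; apply: (mulfI De0); rewrite /ex mulrCA mulVKf // -(dP It) /d -(Kpq It) -(Kps It); ring.
Qed.
Let eyE t : I t -> d t * ey t = py t.
Proof.
move=> It; apply: (mulfI De0); rewrite /ey mulrCA mulVKf // -(dP It) /d -(Kpq It) -(Kps It); ring.
Qed.
Let fxE t : I t -> d t * fx t = rx t.
Proof.
move=> It; apply: (mulfI De0); rewrite /fx mulrCA mulVKf // -(dP It) /d -(Krq It) -(Krs It); ring.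
Qed.
Let fyE t : I t -> d t * fy t = ry t.
Proof.
move=> It; apply: (mulfI De0); rewrite /fy mulrCA mulVKf // -(dP It) /d -(Krq It) -(Krs It); ring.
Qed.

Let exE' t : I t -> d' t * ex t + d t * ex' t = px' t.
Proof. exact: (der_unique HI (derM dd dex) dpx exE). Qed.
Let eyE' t : I t -> d' t * ey t + d t * ey' t = py' t.
Proof. exact: (der_unique HI (derM dd dey) dpy eyE). Qed.
Let fxE' t : I t -> d' t * fx t + d t * fx' t = rx' t.
Proof. exact: (der_unique HI (derM dd dfx) drx fxE). Qed.
Let fyE' t : I t -> d' t * fy t + d t * fy' t = ry' t.
Proof. exact: (der_unique HI (derM dd dfy) dry fyE). Qed.

(** These are the constants [l] taken against [e] and [f]: [cpp = p' . e - p . e'] and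
    [cpr = p' . f - p . f'], and likewise [crp] and [crr] with [r] in place of [p]. *)
Let cpp := De^-1 * (kps * lpq - kpq * lps).
Let crr := De^-1 * (krs * lrq - krq * lrs).
Let cpr := De^-1 * (krs * lpq - krq * lps).
Let crp := De^-1 * (kps * lrq - kpq * lrs).

(** Substituting [e = p / d] cancels [p'] and leaves only the derivative of [1 / d]. In the mixed
    cases [Epr] and [Erp] the cancellation occurs in their sum. *)
Let Epp t : I t -> d t ^+ 2 * cpp = d' t * (px t * px t + py t * py t).
Proof.
move=> It; have -> : cpp = px' t * ex t + py' t * ey t - px t * ex' t - py t * ey' t.
  by rewrite /cpp /ex /ey /ex' /ey' -(Lpq It) -(Lps It); ring.
have h1 := exE It; have h2 := eyE It; have h3 := exE' It; have h4 := eyE' It.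
have h5 : d t ^+ 2 * ex' t = d t * px' t - d' t * px t by rewrite -h3 -h1; ring.
have h6 : d t ^+ 2 * ey' t = d t * py' t - d' t * py t by rewrite -h4 -h2; ring.
have -> : d t ^+ 2 * (px' t * ex t + py' t * ey t - px t * ex' t - py t * ey' t) =
  d t * px' t * (d t * ex t) + d t * py' t * (d t * ey t)
  - px t * (d t ^+ 2 * ex' t) - py t * (d t ^+ 2 * ey' t) by ring.
by rewrite h1 h2 h5 h6; ring.
Qed.

Let Err t : I t -> d t ^+ 2 * crr = d' t * (rx t * rx t + ry t * ry t).
Proof.
move=> It; have -> : crr = rx' t * fx t + ry' t * fy t - rx t * fx' t - ry t * fy' t.
  by rewrite /crr /fx /fy /fx' /fy' -(Lrq It) -(Lrs It); ring.
have h1 := fxE It; have h2 := fyE It; have h3 := fxE' It; have h4 := fyE' It.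
have h5 : d t ^+ 2 * fx' t = d t * rx' t - d' t * rx t by rewrite -h3 -h1; ring.
have h6 : d t ^+ 2 * fy' t = d t * ry' t - d' t * ry t by rewrite -h4 -h2; ring.
have -> : d t ^+ 2 * (rx' t * fx t + ry' t * fy t - rx t * fx' t - ry t * fy' t) =
  d t * rx' t * (d t * fx t) + d t * ry' t * (d t * fy t)
  - rx t * (d t ^+ 2 * fx' t) - ry t * (d t ^+ 2 * fy' t) by ring.
by rewrite h1 h2 h5 h6; ring.
Qed.

Let Epr t : I t -> d t ^+ 2 * cpr = d t * (px' t * rx t + py' t * ry t)
  - d t * (px t * rx' t + py t * ry' t) + d' t * (px t * rx t + py t * ry t).
Proof.
move=> It; have -> : cpr = px' t * fx t + py' t * fy t - px t * fx' t - py t * fy' t.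
  by rewrite /cpr /fx /fy /fx' /fy' -(Lpq It) -(Lps It); ring.
have h1 := fxE It; have h2 := fyE It; have h3 := fxE' It; have h4 := fyE' It.
have h5 : d t ^+ 2 * fx' t = d t * rx' t - d' t * rx t by rewrite -h3 -h1; ring.
have h6 : d t ^+ 2 * fy' t = d t * ry' t - d' t * ry t by rewrite -h4 -h2; ring.
have -> : d t ^+ 2 * (px' t * fx t + py' t * fy t - px t * fx' t - py t * fy' t) =
  d t * px' t * (d t * fx t) + d t * py' t * (d t * fy t)
  - px t * (d t ^+ 2 * fx' t) - py t * (d t ^+ 2 * fy' t) by ring.
by rewrite h1 h2 h5 h6; ring.
Qed.

Let Erp t : I t -> d t ^+ 2 * crp = d t * (rx' t * px t + ry' t * py t)
  - d t * (rx t * px' t + ry t * py' t) + d' t * (px t * rx t + py t * ry t).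
Proof.
move=> It; have -> : crp = rx' t * ex t + ry' t * ey t - rx t * ex' t - ry t * ey' t.
  by rewrite /crp /ex /ey /ex' /ey' -(Lrq It) -(Lrs It); ring.
have h1 := exE It; have h2 := eyE It; have h3 := exE' It; have h4 := eyE' It.
have h5 : d t ^+ 2 * ex' t = d t * px' t - d' t * px t by rewrite -h3 -h1; ring.
have h6 : d t ^+ 2 * ey' t = d t * py' t - d' t * py t by rewrite -h4 -h2; ring.
have -> : d t ^+ 2 * (rx' t * ex t + ry' t * ey t - rx t * ex' t - ry t * ey' t) =
  d t * rx' t * (d t * ex t) + d t * ry' t * (d t * ey t)
  - rx t * (d t ^+ 2 * ex' t) - ry t * (d t ^+ 2 * ey' t) by ring.
by rewrite h1 h2 h5 h6; ring.
Qed.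

Let pp t := px t * px t + py t * py t.
Let pp0 t : I t -> 0 < pp t.
Proof.
move=> It; rewrite lt_neqAle addr_ge0 -?expr2 ?sqr_ge0 // andbT eq_sym.
apply: contra_neq (d0 It); rewrite /pp => h.
have hx : 0 <= px t * px t by rewrite -expr2 sqr_ge0.
have hy : 0 <= py t * py t by rewrite -expr2 sqr_ge0.
have -> : d t = 0 => //.
have /eqP : px t ^+ 2 = 0 by rewrite expr2; lra.
have /eqP : py t ^+ 2 = 0 by rewrite expr2; lra.
by rewrite !sqrf_eq0 /d => /eqP -> /eqP ->; rewrite !mul0r subrr.
Qed.

(** By [Epp] the determinant [d] is constant, so [p = d e] is a constant combination of [q] and
    [s]. *)
Lemma degenerate : cpp = 0 -> exists a b : R, forall t, I t ->
  px t = a * qx t + b * sx t /\ py t = a * qy t + b * sy t.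
Proof.
move=> c0; have [t0 It0] : I !=set0 by case: HI.
have dc t : I t -> d t = d t0.
  have d'0 : der I d (fun=> 0).
    apply: der_ext dd => s Is.
    by apply: (mulIf (lt0r_neq0 (pp0 Is))); rewrite -Epp // c0 mulr0 mul0r.
  by move=> It; exact: (der0_const HI d'0).
exists (d t0 * (De^-1 * kps)), (- (d t0 * (De^-1 * kpq))) => t It.
by rewrite -(exE It) -(eyE It) dc // /ex /ey; split; ring.
Qed.

(** Lagrange's identity [|p|^2 |r|^2 - (p . r)^2 = d^2] turns the Gram entries given by [Epp], [Err]
    and the half sum of [Epr] and [Erp] into a constant value of [(d' / d)^2]. The quotient never
    vanishes, so differentiating its square shows that it is constant. *)
Lemma growth : cpp != 0 -> exists2 k, k != 0 & forall t, I t -> d' t = k * d t.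
Proof.
move=> c0; pose k t := cpp * (d t * (pp t)^-1).
have kE t : I t -> d' t = k t * d t.
  move=> It; apply: (mulIf (lt0r_neq0 (pp0 It))); rewrite /k -Epp // -/(pp t).
  by field; exact: lt0r_neq0 (pp0 It).
have k0 t : I t -> k t != 0.
  move=> It; rewrite mulf_neq0 // mulf_neq0 ?d0 // invr_neq0 //.
  exact: lt0r_neq0 (pp0 It).
pose m := (cpr + crp) / 2.
have k2 t : I t -> k t * k t = cpp * crr - m * m.
  move=> It; have h1 := Epp It; have h2 := Err It; have h3 := Epr It; have h4 := Erp It.
  have h5 : d t ^+ 2 * m = d' t * (px t * rx t + py t * ry t) by rewrite /m; lra.
  have d4 : d t ^+ 4 != 0 by rewrite expf_neq0 // d0.
  apply: (mulfI d4); transitivity ((d t * d' t) ^+ 2); first by rewrite kE //; ring.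
  have -> : d t ^+ 4 * (cpp * crr - m * m) =
    (d t ^+ 2 * cpp) * (d t ^+ 2 * crr) - (d t ^+ 2 * m) ^+ 2 by ring.
  by rewrite h1 h2 h5 /d; ring.
have dpp : der I pp (fun t => px' t * px t + px t * px' t + (py' t * py t + py t * py' t)).
  by apply: derD; exact: derM.
have [k' dk] : exists k', der I k k'.
  eexists; apply: derZ; apply: derM; first exact: dd.
  apply: derV dpp; move=> t It; exact: lt0r_neq0 (pp0 It).
have [t0 It0] : I !=set0 by case: HI.
exists (k t0); first exact: k0.
move=> t It; rewrite (kE t It); congr (_ * _).
have k'0 : der I k (fun=> 0).
  apply: (fun H => der_ext H dk) => s Is.
  have := @der_unique _ I HI _ _ (fun=> _) (fun=> 0) (derM dk dk) (derC _) k2 s Is.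
  rewrite mulrC -mulr2n => /eqP; rewrite mulrn_eq0 /= mulf_eq0 (negPf (k0 s Is)) /=.
  by move/eqP.
exact: (der0_const HI k'0).
Qed.

Lemma polar (x y : R) : x ^+ 2 + y ^+ 2 = 1 -> exists a, x = cos a /\ y = sin a.
Proof.
move=> xy; have x2 : x ^+ 2 <= 1 by rewrite -xy lerDl sqr_ge0.
have x1 : -1 <= x <= 1 by rewrite -ler_norml -sqrtr_sqr -sqrtr1 ler_wsqrtr.
have yE : Num.sqrt (1 - x ^+ 2) = `|y| by rewrite -xy addrAC subrr add0r sqrtr_sqr.
have [y0|y0] := leP 0 y.
  by exists (acos x); rewrite sin_acos // yE ger0_norm // acosK // in_itv.
exists (- acos x); rewrite cosN sinN sin_acos // yE ltr0_norm // opprK.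
by rewrite acosK // in_itv.
Qed.

(** With [J] the quarter turn, [p' = c p + c1 J p], and [r] is a constant combination of [p] and
    [J p]. Since [q] and [s] are constant combinations of [p / d] and [r / d] with [d] proportional
    to [exp (2 c t)], they carry the decaying exponential. *)
Lemma normal_form : cpp != 0 ->
  exists c c0 c1 b00 b02 b22 b31 b11 b33 b13 : R, forall t, I t ->
  let e := expR (c * t) in let e' := expR (- (c * t)) in
  let C := cos (c1 * t + c0) in let S := sin (c1 * t + c0) in
  [/\ px t = e * (b00 * C) /\ py t = e * (b00 * S),
      qx t = e' * (b31 * C - b11 * S) /\ qy t = e' * (b31 * S + b11 * C),
      rx t = e * (b02 * C - b22 * S) /\ ry t = e * (b02 * S + b22 * C) &
      sx t = e' * (b33 * C - b13 * S) /\ sy t = e' * (b33 * S + b13 * C)].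
Proof.
move=> c0; have [k k0 dk] := growth c0; have [t0 It0] : I !=set0 by case: HI.
pose c := k / 2; have kc : k = 2 * c by rewrite /c; field.
(* Chosen so that [|p|^2 = g d], [p . r = g2 d], and [c1] is the angular velocity of [p]. *)
pose g := cpp / k; pose g2 := (cpr + crp) / 2 / k; pose c1 := (cpr - crp) / 4.
have g0 : g != 0 by rewrite mulf_neq0 ?invr_neq0.
have gk : cpp = g * k by rewrite /g divfK.
have g2k : cpr + crp = 2 * g2 * k by rewrite /g2; field.
have c1E : cpr - crp = 4 * c1 by rewrite /c1; field.
have ppE t : I t -> pp t = d t * g.
  move=> It; apply: (mulfI (d0 It)); apply: (mulfI k0).
  by have := Epp It; rewrite gk dk // -/(pp t) => h; lra.
have prE t : I t -> px t * rx t + py t * ry t = d t * g2.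
  move=> It; apply: (mulfI (d0 It)); apply: (mulfI k0).
  have h1 := Epr It; have h2 := Erp It; rewrite dk // in h1 h2.
  have := congr1 ( *%R (d t ^+ 2)) g2k; lra.
(* Expansion of [r] in the orthogonal basis formed by [p] and its quarter turn. *)
have rxE t : I t -> g * rx t = g2 * px t - py t.
  move=> It; apply: (mulfI (d0 It)).
  have := congr1 ( *%R (rx t)) (ppE t It); have := congr1 ( *%R (px t)) (prE t It).
  have hd : d t * py t = (px t * ry t - py t * rx t) * py t by [].
  rewrite /pp; lra.
have ryE t : I t -> g * ry t = g2 * py t + px t.
  move=> It; apply: (mulfI (d0 It)).
  have := congr1 ( *%R (ry t)) (ppE t It); have := congr1 ( *%R (py t)) (prE t It).
  have hd : d t * px t = (px t * ry t - py t * rx t) * px t by [].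
  rewrite /pp; lra.
have rxE' := der_unique HI (derZ g drx) (derB (derZ g2 dpx) dpy) rxE.
have ryE' := der_unique HI (derZ g dry) (derD (derZ g2 dpy) dpx) ryE.
(* The difference of [Epr] and [Erp] gives [p' . r - p . r' = 2 c1 d]; inserting the expansion of
   [r] turns the left-hand side into [2 det (p, p') / g]. *)
have crE t : I t -> px t * py' t - py t * px' t = c1 * pp t.
  move=> It; have h : d t * (2 * c1) = px' t * rx t + py' t * ry t -
      (px t * rx' t + py t * ry' t).
    apply: (mulfI (d0 It)).
    have := Epr It; have := Erp It; have := congr1 ( *%R (d t ^+ 2)) c1E; lra.
  have := congr1 ( *%R g) h; have := congr1 ( *%R c1) (ppE t It).
  have := congr1 ( *%R (px' t)) (rxE t It); have := congr1 ( *%R (py' t)) (ryE t It).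
  have := congr1 ( *%R (px t)) (rxE' t It); have := congr1 ( *%R (py t)) (ryE' t It).
  by rewrite /=; lra.
have dtE t : I t -> px t * px' t + py t * py' t = c * pp t.
  move=> It; have := der_unique HI (derD (derM dpx dpx) (derM dpy dpy)) (derZ g dd)
    (fun t It => etrans (ppE t It) (mulrC _ _)) It.
  by rewrite dk // ppE // kc; lra.
have pxE' t : I t -> px' t = c * px t - c1 * py t.
  move=> It; apply: (mulfI (lt0r_neq0 (pp0 It))).
  have := congr1 ( *%R (px t)) (dtE t It); have := congr1 ( *%R (py t)) (crE t It).
  have hp : pp t * px' t = (px t * px t + py t * py t) * px' t by [].
  lra.
have pyE' t : I t -> py' t = c * py t + c1 * px t.
  move=> It; apply: (mulfI (lt0r_neq0 (pp0 It))).
  have := congr1 ( *%R (py t)) (dtE t It); have := congr1 ( *%R (px t)) (crE t It).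
  have hp : pp t * py' t = (px t * px t + py t * py t) * py' t by [].
  lra.
(* The curve [p], scaled back and rotated back. *)
pose w1 t := expR (- c * t) * (cos (c1 * t) * px t + sin (c1 * t) * py t).
pose w2 t := expR (- c * t) * (cos (c1 * t) * py t - sin (c1 * t) * px t).
have w1c t : I t -> w1 t = w1 t0.
  have dw : der I w1 (fun=> 0); last by move=> It; exact: (der0_const HI dw).
  apply: (fun H => der_ext H (derM (der_exp (- c)) (derD (derM (der_cos c1) dpx)
    (derM (der_sin c1) dpy)))) => s Is.
  by rewrite pxE' // pyE' //; ring.
have w2c t : I t -> w2 t = w2 t0.
  have dw : der I w2 (fun=> 0); last by move=> It; exact: (der0_const HI dw).
  apply: (fun H => der_ext H (derM (der_exp (- c)) (derB (derM (der_cos c1) dpy)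
    (derM (der_sin c1) dpx)))) => s Is.
  by rewrite pxE' // pyE' //; ring.
have ek t : expR (- c * t) * expR (c * t) = 1.
  by rewrite -expRD mulNr addrC subrr expR0.
pose dc t := expR (- c * t) * expR (- c * t) * d t.
have dcc t : I t -> dc t = dc t0.
  have dw : der I dc (fun=> 0); last by move=> It; exact: (der0_const HI dw).
  apply: (fun H => der_ext H (derM (derM (der_exp (- c)) (der_exp (- c))) dd)) => s Is.
  by rewrite dk // kc; ring.
have csq t : cos (c1 * t) * cos (c1 * t) + sin (c1 * t) * sin (c1 * t) = 1.
  by rewrite -!expr2 cos2Dsin2.
(* The squared length of the constant vector [(w1, w2)]; its polar angle [a] will be the initial
   phase. *)
pose h2 := dc t0 * g.
have ww : w1 t0 ^+ 2 + w2 t0 ^+ 2 = h2.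
  rewrite /h2 /dc -mulrA -ppE // /pp /w1 /w2.
  have := csq t0; move: (cos _) (sin _) (expR _) => C S e CS.
  by have := congr1 ( *%R (e * e * (px t0 * px t0 + py t0 * py t0))) CS; lra.
have h20 : 0 < h2.
  rewrite /h2 /dc -mulrA -ppE // mulr_gt0 ?pp0 //.
  by rewrite mulr_gt0 // expR_gt0.
pose h := Num.sqrt h2; have hh : h * h = h2 by rewrite -expr2 sqr_sqrtr // ltW.
have h0 : h != 0 by rewrite gt_eqF // sqrtr_gt0.
have [a [aC aS]] : exists a, w1 t0 / h = cos a /\ w2 t0 / h = sin a.
  apply: polar; apply: (mulfI (lt0r_neq0 h20)); rewrite mulr1 -{2}ww -{1}hh.
  by field.
have w1h : w1 t0 = h * cos a by rewrite -aC mulrC divfK.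
have w2h : w2 t0 = h * sin a by rewrite -aS mulrC divfK.
have pxF t : I t -> px t = expR (c * t) * (h * cos (c1 * t + a)).
  move=> It; rewrite cosD.
  have -> : h * (cos (c1 * t) * cos a - sin (c1 * t) * sin a) =
      cos (c1 * t) * w1 t - sin (c1 * t) * w2 t.
    by rewrite w1c // w2c // w1h w2h; ring.
  have := csq t; have := ek t; rewrite /w1 /w2.
  move: (cos _) (sin _) (expR (c * t)) (expR (- c * t)) => C S e e' ee CS.
  have -> : e * (C * (e' * (C * px t + S * py t)) - S * (e' * (C * py t - S * px t))) =
    (e' * e) * (C * C + S * S) * px t by ring.
  by rewrite ee CS !mul1r.
have pyF t : I t -> py t = expR (c * t) * (h * sin (c1 * t + a)).
  move=> It; rewrite sinD.
  have -> : h * (sin (c1 * t) * cos a + cos (c1 * t) * sin a) =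
      sin (c1 * t) * w1 t + cos (c1 * t) * w2 t.
    by rewrite w1c // w2c // w1h w2h; ring.
  have := csq t; have := ek t; rewrite /w1 /w2.
  move: (cos _) (sin _) (expR (c * t)) (expR (- c * t)) => C S e e' ee CS.
  have -> : e * (S * (e' * (C * px t + S * py t)) + C * (e' * (C * py t - S * px t))) =
    (e' * e) * (C * C + S * S) * py t by ring.
  by rewrite ee CS !mul1r.
have D0 : dc t0 != 0 by rewrite !mulf_neq0 ?d0 // gt_eqF // expR_gt0.
have dF t : I t -> d t = expR (c * t) * expR (c * t) * dc t0.
  move=> It; rewrite -(dcc t It) /dc; have := ek t.
  move: (expR (c * t)) (expR (- c * t)) => e e' ee.
  have -> : e * e * (e' * e' * d t) = (e' * e) * (e' * e) * d t by ring.
  by rewrite ee !mul1r.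
have rxF t : I t -> rx t = expR (c * t) *
    (g2 * h / g * cos (c1 * t + a) - h / g * sin (c1 * t + a)).
  move=> It; apply: (mulfI g0); rewrite rxE // pxF // pyF //; by field.
have ryF t : I t -> ry t = expR (c * t) *
    (g2 * h / g * sin (c1 * t + a) + h / g * cos (c1 * t + a)).
  move=> It; apply: (mulfI g0); rewrite ryE // pxF // pyF //; by field.
(* There is no [b20], because the phase is measured from the direction of [p] itself. *)
exists c, a, c1, h, (g2 * h / g), (h / g).
exists ((- krq * h + kpq * (g2 * h / g)) / dc t0), (kpq * (h / g) / dc t0).
exists ((- krs * h + kps * (g2 * h / g)) / dc t0), (kps * (h / g) / dc t0).
move=> t It e e' C S.
have ee' : e * e' = 1 by rewrite /e /e' -expRD subrr expR0.
have e0 : e != 0 by rewrite gt_eqF // expR_gt0.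
have e'E : e' = e^-1 by apply: (mulfI e0); rewrite ee' mulfV.
(* Applied to [d q = det (p, q) r - det (r, q) p] and its analogue for [s]; dividing by [d] changes
   the exponential [e] into [e']. *)
have dq x y z : d t * x = y * px t + z * rx t -> d t * x = d t * (e' *
   ((y * h + z * (g2 * h / g)) / dc t0 * C - z * (h / g) / dc t0 * S)).
  by move=> ->; rewrite dF // pxF // rxF // -/e -/C -/S e'E; field; rewrite g0 D0 e0.
have dq' x y z : d t * x = y * py t + z * ry t -> d t * x = d t * (e' *
   ((y * h + z * (g2 * h / g)) / dc t0 * S + z * (h / g) / dc t0 * C)).
  by move=> ->; rewrite dF // pyF // ryF // -/e -/C -/S e'E; field; rewrite g0 D0 e0.
split; split; rewrite -/e -/C -/S.
- exact: pxF.
- exact: pyF.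
- by apply: (mulfI (d0 It)); apply: dq; rewrite /d -(Krq It) -(Kpq It); ring.
- by apply: (mulfI (d0 It)); apply: dq'; rewrite /d -(Krq It) -(Kpq It); ring.
- exact: rxF.
- exact: ryF.
- by apply: (mulfI (d0 It)); apply: dq; rewrite /d -(Krs It) -(Kps It); ring.
- by apply: (mulfI (d0 It)); apply: dq'; rewrite /d -(Krs It) -(Kps It); ring.
Qed.

End RegularPairing.

(** * The necessary form of the solution *)

(** [gdet] as a function of the Jacobian matrix alone, so that matrix products can act on it. *)
Definition minor (R : realType) (J : 'M[R]_(4, 2)) (i j : 'I_4) : R :=
  J i 0 * J j 1 - J j 0 * J i 1.

(** * Coordinates in which a map is a graph *)

Section LocalGraph.
Context {R : realType}.

Lemma minor_mulmx (J : 'M[R]_(4, 2)) (N : 'M[R]_2) i j :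
  minor (J *m N) i j = minor J i j * \det N.
Proof. by rewrite /minor det2 !mxE !sum2; ring. Qed.

Lemma gdetE (v : 'cV[R]_2 -> 'cV[R]_4) i j z : gdet v i j z = minor (jac v z) i j.
Proof.
rewrite /gdet det2 /minor.
have E0 : (0 : 'I_2) = lshift 1 (0 : 'I_1) by apply: val_inj.
have E1 : (1 : 'I_2) = rshift 1 (0 : 'I_1) by apply: val_inj.
have l a : row_mx (grad (fun w => v w i 0) z) (grad (fun w => v w j 0) z) a (0 : 'I_2)
    = jac v z i a.
  by rewrite [X in row_mx _ _ _ X]E0 row_mxEl !mxE.
have r a : row_mx (grad (fun w => v w i 0) z) (grad (fun w => v w j 0) z) a (1 : 'I_2)
    = jac v z j a.
  by rewrite [X in row_mx _ _ _ X]E1 row_mxEr !mxE.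
by rewrite !l !r; ring.
Qed.

Lemma ball_interval (a s : R) : 0 < s -> open_interval (ball a s).
Proof.
move=> s0; split; [by exists a; exact: ballxx|exact: ball_open|].
move=> x y; rewrite -!ball_normE /= !ltr_distlC => /andP[x1 x2] /andP[y1 y2] z /andP[xz zy].
by rewrite ltr_distlC (lt_le_trans x1 xz) (le_lt_trans zy y2).
Qed.

Definition col2 (a b : R) : 'cV[R]_2 := \col_(i < 2) nth 0 [:: a; b] i.

Lemma col2E a b : (col2 a b 0 0 = a) * (col2 a b 1 0 = b).
Proof. by rewrite !mxE. Qed.

(** The norm is the maximum norm, so balls are squares; functions of one coordinate then live on
    intervals. *)
Lemma ball_col2 (y z : 'cV[R]_2) (s : R) : 0 < s ->
  (ball y s z <-> ball (y 0 0) s (z 0 0) /\ ball (y 1 0) s (z 1 0)).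
Proof.
move=> s0; split; first by case=> _ h; split; apply: h.
by move=> [h0 h1]; split => // i j; rewrite ord1; elim/ord2P: i.
Qed.

Variables (D : set 'cV[R]_2) (w : 'cV[R]_2 -> 'cV[R]_4).
Hypotheses (oD : open D) (wC : smooth_on D w).
Hypothesis g02 : forall z, D z -> minor (jac w z) 0 2 = 0.
Hypothesis g13 : forall z, D z -> minor (jac w z) 1 3 = 0.
Hypothesis g0123 : forall z, D z -> minor (jac w z) 0 1 - minor (jac w z) 2 3 != 0.

(** The first two components of [w] are taken as coordinates. In these the vanishing minors say that
    the third component does not depend on the second coordinate, nor the fourth on the first, and
    on a square each becomes a function of one variable. *)
Lemma local_graph z0 : D z0 -> minor (jac w z0) 0 1 != 0 ->
  exists (U V : set 'cV[R]_2) (psi : 'cV[R]_2 -> 'cV[R]_2) (J1 J2 : set R) (f1 f2 : R -> R),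
    [/\ diffeomorphism U V psi /\ (V z0 /\ V `<=` D),
        [/\ open_interval J1, open_interval J2, smooth_on J1 f1 & smooth_on J2 f2],
        forall z, U z -> [/\ J1 (z 0 0), J2 (z 1 0) &
          1 - derive1 f1 (z 0 0) * derive1 f2 (z 1 0) != 0] &
        forall z, U z -> w (psi z) = graph_vec f1 f2 z].
Proof.
move=> Dz0 m0.
pose F x := col2 (w x 0 0) (w x 1 0).
have CF k (E : set 'cV[R]_2) : open E -> E `<=` D -> Ck k E F.
  move=> oE ED; apply: Ck_mx => // i j; elim/ord2P: i; under eq_fun do rewrite mxE /=.
    by apply: Ck_sub ED _; apply: Ck_entry => //; exact: wC.
  by apply: Ck_sub ED _; apply: Ck_entry => //; exact: wC.
have detF x : \det (jac F x) = minor (jac w x) 0 1.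
  rewrite det2 /minor !mxE /partial.
  have -> : (fun w0 => F w0 0 0) = (fun w0 => w w0 0 0) by apply/funext => y; rewrite mxE.
  have -> : (fun w0 => F w0 1 0) = (fun w0 => w w0 1 0) by apply/funext => y; rewrite mxE.
  by rewrite [X in _ - X = _]mulrC.
have [r0 r00 r0E] : exists2 r, 0 < r & forall x, ball z0 r x -> D x /\ \det (jac F x) != 0.
  have cd : {for z0, continuous (fun x => \det (jac F x))}.
    have : Ck 0 D (fun x => \det (jac F x)) by apply: Ck_det => //; apply: Ck_jac => //; exact: CF.
    by apply.
  have nz : \forall x \near z0, \det (jac F x) != 0.
    have nn : nbhs (\det (jac F z0)) [set a : R | a != 0].
      by apply: open_nbhs_nbhs; split; [exact: open_neq|rewrite /= detF].
    have cd' : (fun x => \det (jac F x)) @ z0 --> \det (jac F z0) by [].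
    exact: (cd' _ nn).
  have : nbhs z0 (D `&` [set x | \det (jac F x) != 0]).
    by apply: filterI nz; exact: open_nbhs_nbhs.
  move=> /nbhs_ballP[r /= rp rE].
  by exists r => // x /rE.
pose E := ball z0 r0; have oE : open E by exact: ball_open.
have ED : E `<=` D by move=> x /r0E[].
have uF x : E x -> jac F x \in unitmx by move=> /r0E[_ h]; rewrite unitmxE unitfE.
have dF x : E x -> differentiable F x by have /CkS[df _] := CF 1 E oE ED; exact: df.
pose H x (h : 'cV[R]_2) := invmx (jac F x) *m h.
have HK x h : E x -> H x ('D_h F x) = h.
  by move=> Ex; rewrite (derive_jac h (dF x Ex)); exact: (mulKmx (uF x Ex)).
have KH x h : E x -> 'D_(H x h) F x = h.
  by move=> Ex; rewrite (derive_jac _ (dF x Ex)); exact: (mulKVmx (uF x Ex)).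
have HC h k : Ck k E (H^~ h).
  apply: Ck_mulmx => //; last exact: Ck_cst.
  apply: Ck_invmx => //; first by move=> x /r0E[].
  by apply: Ck_jac => //; exact: CF.
have [r [g [rp rE opF gF gC]]] := @inverse_function R _ (coords_col R 2) E F H oE
  (CF 1 E oE ED) HK KH z0 (ballxx _ r00) HC.
have oFb : open (F @` ball z0 r) by apply: opF => //; exact: ball_open.
pose y0 := F z0.
have /nbhs_ballP[s /= s0 sE] : nbhs y0 (F @` ball z0 r).
  by apply: open_nbhs_nbhs; split => //; exists z0 => //; exact: ballxx.
pose U := ball y0 s; pose V := [set x | ball z0 r x /\ U (F x)].
have oU : open U by exact: ball_open.
have Fg z : U z -> F (g z) = z by move=> /sE[x bx <-]; rewrite gF.
have bg z : U z -> ball z0 r (g z) by move=> /sE[x bx <-]; rewrite gF.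
have Dg z : U z -> D (g z) by move=> /bg/rE/ED.
have oV : open V.
  rewrite openE => x [bx Ux]; apply: filterI.
    by apply: open_nbhs_nbhs; split => //; exact: ball_open.
  have cF := differentiable_continuous (dF x (rE x bx)).
  have {}cF : F @ x --> F x by [].
  by apply: (cF U); exact: open_nbhs_nbhs.
have gCU k : Ck k U g by exact: Ck_sub sE (gC k).
have wgC k : Ck k U (fun z => w (g z)).
  by apply: (Ck_comp (coords_col R 2) (coords_mx R 4 1) oU oD Dg) => //; exact: wC.
have dwg z : U z -> differentiable (fun z => w (g z)) z.
  by have /CkS[df _] := wgC 1; exact: df.
have w0 z : U z -> w (g z) 0 0 = z 0 0 by move=> Uz; rewrite -{2}(Fg z Uz) mxE.
have w1 z : U z -> w (g z) 1 0 = z 1 0 by move=> Uz; rewrite -{2}(Fg z Uz) mxE.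
pose T z := jac (fun z => w (g z)) z.
have TE z : U z -> T z = jac w (g z) *m jac g z.
  move=> Uz; apply: jac_comp.
    by have /CkS[df _] := gCU 1; exact: df.
  by have /CkS[df _] := wC 1; exact/df/Dg.
have nU z (P : 'cV[R]_2 -> Prop) : U z -> (forall x, U x -> P x) -> \near z, P z.
  by move=> Uz UP; near=> x; apply: UP; near: x; exact: open_nbhs_nbhs.
have T0 z j : U z -> T z 0 j = (0 == j)%:R.
  move=> Uz; rewrite mxE /partial -(derive_coordinate 0 j z); apply: near_eq_derive.
  exact: nU Uz w0.
have T1 z j : U z -> T z 1 j = (1 == j)%:R.
  move=> Uz; rewrite mxE /partial -(derive_coordinate 1 j z); apply: near_eq_derive.
  exact: nU Uz w1.
have T21 z : U z -> T z 2 1 = 0.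
  move=> Uz; have : minor (T z) 0 2 = 0 by rewrite TE // minor_mulmx g02 ?mul0r //; exact: Dg.
  by rewrite /minor !T0 //= mul1r mulr0 subr0.
have T30 z : U z -> T z 3 0 = 0.
  move=> Uz; have : minor (T z) 1 3 = 0 by rewrite TE // minor_mulmx g13 ?mul0r //; exact: Dg.
  by rewrite /minor !T1 //= mul0r mulr1 sub0r => /eqP; rewrite oppr_eq0 => /eqP.
(* Values on the two axes of the square [U]; [const] below carries them over the whole square. *)
pose f1 a := w (g (col2 a (y0 1 0))) 2 0; pose f2 b := w (g (col2 (y0 0 0) b)) 3 0.
pose J1 := ball (y0 0 0) s; pose J2 := ball (y0 1 0) s.
have UE z : U z <-> J1 (z 0 0) /\ J2 (z 1 0) by exact: ball_col2.
have U1 a : J1 a -> U (col2 a (y0 1 0)).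
  by move=> Ja; apply/UE; rewrite !(col2E a (y0 1 0)); split => //; exact: ballxx.
have U2 b : J2 b -> U (col2 (y0 0 0) b).
  by move=> Jb; apply/UE; rewrite !(col2E (y0 0 0) b); split => //; exact: ballxx.
have oJ1 : open J1 by exact: ball_open.
have oJ2 : open J2 by exact: ball_open.
have f1C : smooth_on J1 f1.
  move=> k; apply: Ck_entry => //.
  apply: (Ck_comp (coords_col R 2) (coords_mx R 4 1) oJ1 oU (g := fun a => col2 a (y0 1 0))
    (f := fun z => w (g z))) => //.
  apply: Ck_mx => // i j; elim/ord2P: i; under eq_fun do rewrite mxE /=;
    [exact: Ck_id|exact: Ck_cst].
have f2C : smooth_on J2 f2.
  move=> k; apply: Ck_entry => //.
  apply: (Ck_comp (coords_col R 2) (coords_mx R 4 1) oJ2 oU (g := fun b => col2 (y0 0 0) b)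
    (f := fun z => w (g z))) => //.
  apply: Ck_mx => // i j; elim/ord2P: i; under eq_fun do rewrite mxE /=;
    [exact: Ck_cst|exact: Ck_id].
have Useg z z' (t : R) : U z -> U z' -> 0 <= t <= 1 -> U (z + t *: (z' - z)).
  move=> Uz Uz' /andP[t0 t1]; apply/UE.
  have cv (a b c : R) : ball a s b -> ball a s c -> ball a s (b + t * (c - b)).
    rewrite -!ball_normE /= !ltr_distlC => /andP[x1 x2] /andP[y1 y2].
    have t1' : 0 <= 1 - t by rewrite subr_ge0.
    have [bc|/ltW cb] := leP b c.
      have bc' : 0 <= c - b by rewrite subr_ge0.
      by have h1 := mulr_ge0 t0 bc'; have h2 := mulr_ge0 t1' bc'; apply/andP; split; lra.
    have cb' : 0 <= b - c by rewrite subr_ge0.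
    by have h1 := mulr_ge0 t0 cb'; have h2 := mulr_ge0 t1' cb'; apply/andP; split; lra.
  have /UE[a1 a2] := Uz; have /UE[b1 b2] := Uz'.
  by rewrite !mxE; split; exact: cv.
have const i j z z' : U z -> U z' -> (forall x, U x -> T x i j = 0) ->
    z' - z = (z' j 0 - z j 0) *: delta_mx j 0 -> w (g z') i 0 = w (g z) i 0.
  move=> Uz Uz' Tij zz.
  have dfi x : U x -> differentiable (fun z => w (g z) i 0) x.
    by move=> Ux; have /CkS[df _] := Ck_entry i 0 oU (wgC 1%N); exact: df.
  have [t t01|t /andP[t0 t1]] := @segment_MVT R 'cV[R]_2 (fun z => w (g z) i 0) z (z' - z).
    by apply: dfi; exact: Useg.
  rewrite [z + (_ - _)]addrC subrK => /eqP; rewrite subr_eq => /eqP ->.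
  have Ux : U (z + t *: (z' - z)) by apply: Useg => //; rewrite !ltW.
  move: Ux; move: (z + t *: (z' - z)) => x Ux; rewrite zz.
  rewrite deriveE; last exact: dfi.
  rewrite linearZ /= -deriveE; last exact: dfi.
  have := Tij _ Ux; rewrite mxE /partial => ->.
  by rewrite scaler0 add0r.
have w2 z : U z -> w (g z) 2 0 = f1 (z 0 0).
  move=> Uz; have /UE[Ja Jb] := Uz; apply: (const 2 1 _ _ (U1 _ Ja) Uz T21).
  apply/matrixP => i j; rewrite ord1; elim/ord2P: i; rewrite !mxE /=; ring.
have w3 z : U z -> w (g z) 3 0 = f2 (z 1 0).
  move=> Uz; have /UE[Ja Jb] := Uz; apply: (const 3 0 _ _ (U2 _ Jb) Uz T30).
  apply/matrixP => i j; rewrite ord1; elim/ord2P: i; rewrite !mxE /=; ring.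
have wE z : U z -> w (g z) = graph_vec f1 f2 z.
  move=> Uz; apply/matrixP => i j; rewrite ord1; elim/ord4P: i; rewrite [RHS]mxE /=.
  - exact: w0.
  - exact: w1.
  - exact: w2.
  - exact: w3.
have UJ z : U z -> J1 (z 0 0) /\ J2 (z 1 0) by move=> /UE.
have TJ z : U z -> T z = jac (graph_vec f1 f2) z.
  by move=> Uz; apply: near_eq_jac; exact: nU Uz wE.
exists U, V, g, J1, J2, f1, f2; split=> //.
- split; last first.
    by split=> [|x [bx _]]; [split; exact: ballxx|exact/ED/rE].
  split => //.
  + split.
    * by move=> z Uz; split; [exact: bg|rewrite Fg].
    * by move=> x y; rewrite !inE => Ux Uy e; rewrite -(Fg x Ux) -(Fg y Uy) e.
    * by move=> x [bx Ux]; exists (F x) => //; rewrite gF.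
  + exists F; split => [k|//]; apply: CF => //.
    by move=> x [bx _]; exact/ED/rE.
- by split => //; exact: ball_interval.
- move=> z Uz; have [Ja Jb] := UJ z Uz; split => //.
  (* The difference of minors, multiplied by the nonzero determinant of [jac g], is [1 - f1' f2'] in
     the new coordinates. *)
  have := g0123 (Dg z Uz); apply: contra_neq => h.
  have dg : \det (jac g z) != 0.
    have : minor (T z) 0 1 = 1 by rewrite /minor !T0 // !T1 //=; ring.
    rewrite TE // minor_mulmx => h1; apply/eqP => h2; move: h1.
    by rewrite h2 mulr0 => /esym/eqP; rewrite oner_eq0.
  apply: (mulIf dg); rewrite mul0r mulrBl -!minor_mulmx -TE // TJ //.
  rewrite (jac_graph_vec f1C f2C UJ Uz) /minor !mxE /=.
  by rewrite -[RHS]h; ring.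
Unshelve. all: by end_near. Qed.

End LocalGraph.

Lemma is_derive_entry (R : realType) m n (B : R -> 'M[R]_(m, n)) i j (t : R) :
  differentiable B t -> is_derive t (1 : R) (fun s => B s i j) (derive1 B t i j).
Proof.
move=> dB; have cc := @mx_coord_continuous R m n i j.
have H := derive_linear_comp (L := mx_coord i j) (1 : R) cc dB.
split; last by rewrite derive1E; exact: H.
exact: (diff_derivable (differentiable_linear_comp (L := mx_coord i j) cc dB)).
Qed.

(** * Part (ii): from the Euler equations to the normal form *)

Section Necessary.
Context {R : realType}.
Variables (D : set 'cV[R]_2) (I : set R) (A : R -> 'M[R]_(2, 4)).
Variable v : 'cV[R]_2 -> 'cV[R]_4.
Hypotheses (dD : domain D) (oI : open_interval I) (AC : smooth_on I A) (vC : smooth_on D v).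
Hypothesis P0 : forall z t, D z -> I t -> \det (jac ((flow A v)^~ t) z) != 0.
Hypothesis euler : gives_euler_solution D I (flow A v).
Hypothesis cons : constraints_exactly_g13_g24 D v.
Hypothesis indep : columns_independent I A.

Let A1 := derive1 A.
Let A2 := derive1 A1.

Let oD : open D. Proof. by case: dD. Qed.

Lemma constraintE (alpha : 'M[R]_4) : is_constraint D v alpha <->
  forall z, D z -> let g := minor (jac v z) in
    alpha 0 1 * g 0 1 + alpha 0 2 * g 0 2 + alpha 0 3 * g 0 3 +
    alpha 1 2 * g 1 2 + alpha 1 3 * g 1 3 + alpha 2 3 * g 2 3 = 0.
Proof.
suff E z : \sum_(i < 4) \sum_(j < 4 | (i < j)%N) alpha i j * gdet v i j z =
    let g := minor (jac v z) in
    alpha 0 1 * g 0 1 + alpha 0 2 * g 0 2 + alpha 0 3 * g 0 3 +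
    alpha 1 2 * g 1 2 + alpha 1 3 * g 1 3 + alpha 2 3 * g 2 3.
  by split => h z Dz; have := h z Dz; rewrite E.
rewrite sum4; under eq_bigr do rewrite gdetE.
under [X in _ + X + _ + _]eq_bigr do rewrite gdetE.
under [X in _ + _ + X + _]eq_bigr do rewrite gdetE.
under [X in _ + _ + _ + X]eq_bigr do rewrite gdetE.
rewrite !(big_mkcond (fun j : 'I_4 => _ < _)%N) !sum4 /=.
by rewrite !add0r !addr0 !addrA.
Qed.

Lemma minor02 z : D z -> minor (jac v z) 0 2 = 0.
Proof.
move=> Dz; have [_] := cons (delta_mx 0 2).
have /[swap]/[apply] : exists a b : R, forall i j : 'I_4, (i < j)%N ->
   (delta_mx 0 2 : 'M[R]_4) i j = (a *: delta_mx 0 2 + b *: delta_mx 1 3 : 'M[R]_4) i j.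
  by exists 1, 0 => i j _; rewrite scale1r scale0r addr0.
move=> /constraintE/(_ z Dz); rewrite /= !mxE /=.
by rewrite !mul0r !addr0 add0r mul1r.
Qed.

Lemma minor13 z : D z -> minor (jac v z) 1 3 = 0.
Proof.
move=> Dz; have [_] := cons (delta_mx 1 3).
have /[swap]/[apply] : exists a b : R, forall i j : 'I_4, (i < j)%N ->
   (delta_mx 1 3 : 'M[R]_4) i j = (a *: delta_mx 0 2 + b *: delta_mx 1 3 : 'M[R]_4) i j.
  by exists 0, 1 => i j _; rewrite scale1r scale0r add0r.
move=> /constraintE/(_ z Dz); rewrite /= !mxE /=.
by rewrite !mul0r !addr0 !add0r mul1r.
Qed.

Lemma constraint_zero (alpha : 'M[R]_4) : is_constraint D v alpha ->
  [/\ alpha 0 1 = 0, alpha 0 3 = 0, alpha 1 2 = 0 & alpha 2 3 = 0].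
Proof.
by move=> /cons[a [b E]]; split; rewrite E // !mxE /= !mulr0 addr0.
Qed.

(** Zero divergence makes the Jacobian determinant of the flow constant in time. By Cauchy-Binet it
    is the sum of [det (a_i, a_j) g_ij], and the coefficients here are the time derivatives of these
    determinants. *)
Lemma det_constraint t : I t -> is_constraint D v
  (\matrix_(i, j) (A1 t 0 i * A t 1 j - A1 t 0 j * A t 1 i +
                   (A t 0 i * A1 t 1 j - A t 0 j * A1 t 1 i))).
Proof.
move=> It; apply/constraintE => z Dz; have [W [J [u [p [Wz Jt uP pP]]]]] := euler Dz It.
have /trace_quotient := velocity_jac (AC 2) (vC 1) uP Wz Jt.
have [_ _ /(_ (flow A v z t) t)] := pP; case; first by exists z.
rewrite divergenceE => _ ->; rewrite mul0r /minor /= -/A1.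
move: (jac v z) (A t) (A1 t) => N B C; rewrite !mxE !sum4 => h; rewrite [RHS]h; ring.
Qed.

(** Smoothness is known jointly in space and time on [Om], so the spatial Hessian is treated through
    the space-time directions [e j]. *)
Lemma pressure_gradient_jac (Om : set ('cV[R]_2 * R)) (p : 'cV[R]_2 -> R -> R) x t :
  open Om -> Ck 2 Om (fun q => p q.1 q.2) -> Om (x, t) ->
  differentiable (grad (p^~ t)) x /\
  jac (grad (p^~ t)) x 0 1 = jac (grad (p^~ t)) x 1 0.
Proof.
move=> oO pC Ox; pose e (j : 'I_2) : 'cV[R]_2 * R := (delta_mx j 0, 0).
pose pp (q : 'cV[R]_2 * R) := p q.1 q.2.
have gE y s i : grad (p^~ s) y i 0 = 'D_(e i) pp (y, s).
  by rewrite mxE /partial derive_slicel.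
split.
  pose G (q : 'cV[R]_2 * R) : 'cV[R]_2 := \col_i 'D_(e i) pp q.
  have GC : Ck 1 Om G.
    apply: Ck_mx => // i j; under eq_fun do rewrite mxE.
    by have /CkS[_] := pC; exact.
  have dG : differentiable G (x, t) by have /CkS[dG _] := GC; exact: dG.
  have -> : grad (p^~ t) = fun y => G (y, t).
    by apply/funext => y; apply/matrixP => i j; rewrite ord1 gE mxE.
  apply: (@differentiable_slicel _ _ _ (fun y s => G (y, s))).
  by rewrite (_ : (fun q => G (q.1, q.2)) = G) //; apply/funext => -[].
have jE i j : jac (grad (p^~ t)) x i j = 'D_(e j) ('D_(e i) pp) (x, t).
  rewrite mxE /partial.
  have -> : (fun w => grad (p^~ t) w i 0) = fun w => 'D_(e i) pp (w, t).
    by apply/funext => w; rewrite gE.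
  rewrite (derive_slicel (fun w s => 'D_(e i) pp (w, s))).
  by rewrite (_ : (fun q => 'D_(e i) pp (q.1, q.2)) = 'D_(e i) pp) //; apply/funext => -[].
by rewrite !jE; exact: derive_sym oO pC Ox.
Qed.

(** Let [N] be the Jacobian of [v] and [G] the Hessian of the pressure. Differentiating
    [A'' v = - grad p] in [z] gives [A'' N = - G A N], so the transpose of [A N] times [A'' N] is
    symmetric; its off-diagonal entries differ by the sum stated. *)
Lemma curl_constraint t : I t -> is_constraint D v
  (\matrix_(i, j) (A t 0 i * A2 t 0 j + A t 1 i * A2 t 1 j -
                   (A t 0 j * A2 t 0 i + A t 1 j * A2 t 1 i))).
Proof.
move=> It; apply/constraintE => z Dz; have [W [J [u [p [Wz Jt uP pP]]]]] := euler Dz It.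
have [[oW WD] [oJ JI] oS _ _] := uP; have [_ pC pE] := pP.
have Sx : swept (flow A v) W J (flow A v z t, t) by exists z.
have [dg sg] := pressure_gradient_jac oS (pC 2) Sx.
have dv : differentiable v z by have /CkS[dv _] := vC 1; exact/dv/WD.
(* The sign is written as a scalar matrix so that [jac_mulmx] applies to both sides. *)
have accE y : W y -> A2 t *m v y = (-1)%:M *m grad (p^~ t) (flow A v y t).
  move=> Wy; have [|E _] := pE (flow A v y t) t; first by exists y.
  rewrite -(velocity_acc (AC 2) uP Wy Jt); apply/eqP.
  by rewrite mul_scalar_mx scaleN1r -addr_eq0 E.
have dx : differentiable ((flow A v)^~ t) z by exact: differentiable_mulmx.
have dgx : differentiable (fun y => grad (p^~ t) (flow A v y t)) z.
  exact: (differentiable_comp dx dg).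
have E : A2 t *m jac v z = (-1)%:M *m (jac (grad (p^~ t)) (flow A v z t) *m (A t *m jac v z)).
  have := jac_comp dx dg; rewrite (jac_mulmx (A t) dv : jac ((flow A v)^~ t) z = _) => <-.
  rewrite -(jac_mulmx (A2 t) dv) -(jac_mulmx (-1)%:M dgx).
  apply: near_eq_jac; near=> y; apply: accE; near: y; exact: open_nbhs_nbhs.
move: E sg; rewrite /minor /=.
move: (jac (grad _) _) (jac v z) (A t) (A2 t) => G N B C E sg.
have e00 : (C *m N) 0 0 = - (G *m (B *m N)) 0 0 by rewrite E mul_scalar_mx mxE mulN1r.
have e01 : (C *m N) 0 1 = - (G *m (B *m N)) 0 1 by rewrite E mul_scalar_mx mxE mulN1r.
have e10 : (C *m N) 1 0 = - (G *m (B *m N)) 1 0 by rewrite E mul_scalar_mx mxE mulN1r.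
have e11 : (C *m N) 1 1 = - (G *m (B *m N)) 1 1 by rewrite E mul_scalar_mx mxE mulN1r.
have : (B *m N) 0 0 * (C *m N) 0 1 + (B *m N) 1 0 * (C *m N) 1 1 -
    ((B *m N) 0 1 * (C *m N) 0 0 + (B *m N) 1 1 * (C *m N) 1 0) = 0.
  rewrite e00 e01 e10 e11; move: (B *m N) => Q; rewrite !mxE !sum2 sg; ring.
by rewrite !mxE !sum4 => <-; ring.
Unshelve. all: by end_near. Qed.

Lemma der_entry i j : der I (fun t => A t i j) (fun t => A1 t i j).
Proof.
by move=> t It; apply: is_derive_entry; have /CkS[dA _] := AC 1; exact: dA.
Qed.

Lemma der_entry1 i j : der I (fun t => A1 t i j) (fun t => A2 t i j).
Proof.
move=> t It; apply: is_derive_entry.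
by have /CkS[dA _] := Ck_derive1 (AC 2); exact: dA.
Qed.

Lemma indep_columns (l0 l1 l2 l3 : R) :
  (forall t, I t -> l0 * A t 0 0 + l1 * A t 0 1 + l2 * A t 0 2 + l3 * A t 0 3 = 0 /\
    l0 * A t 1 0 + l1 * A t 1 1 + l2 * A t 1 2 + l3 * A t 1 3 = 0) ->
  [/\ l0 = 0, l1 = 0, l2 = 0 & l3 = 0].
Proof.
move=> h; pose l (j : 'I_4) := nth 0 [:: l0; l1; l2; l3] j.
suff H j : l j = 0 by split; [exact: (H 0)|exact: (H 1)|exact: (H 2)|exact: (H 3)].
apply: indep => t It; have [h0 h1] := h t It.
apply/matrixP => i i'; rewrite sum4 !mxE /l /=.
by elim/ord2P: i; [exact: h0|exact: h1].
Qed.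

(** The two families of constraints make [K i j] and [L i j] constant between the indices 0, 2 and
    1, 3. Independence of the columns then excludes all but the regular case with [cpp != 0]. *)
Lemma flow_normal_form : exists (c c0 c1 : R) (b00 b02 b22 b31 b11 b33 b13 : R),
  forall t, I t ->
  let e := expR (c * t) in let e' := expR (- (c * t)) in
  let C := cos (c1 * t + c0) in let S := sin (c1 * t + c0) in
  [/\ A t 0 0 = e * (b00 * C) /\ A t 1 0 = e * (b00 * S),
      A t 0 1 = e' * (b31 * C - b11 * S) /\ A t 1 1 = e' * (b31 * S + b11 * C),
      A t 0 2 = e * (b02 * C - b22 * S) /\ A t 1 2 = e * (b02 * S + b22 * C) &
      A t 0 3 = e' * (b33 * C - b13 * S) /\ A t 1 3 = e' * (b33 * S + b13 * C)].
Proof.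
have [t0 It0] : I !=set0 by case: oI.
pose K i j t := A t 0 i * A t 1 j - A t 1 i * A t 0 j.
pose L i j t := A1 t 0 i * A t 0 j + A1 t 1 i * A t 1 j - A t 0 i * A1 t 0 j - A t 1 i * A1 t 1 j.
have dK i j : der I (K i j) (fun t => A1 t 0 i * A t 1 j + A t 0 i * A1 t 1 j
    - (A1 t 1 i * A t 0 j + A t 1 i * A1 t 0 j)).
  by apply: derB; apply: derM; exact: der_entry.
have dL i j : der I (L i j) (fun t => A2 t 0 i * A t 0 j + A1 t 0 i * A1 t 0 j
    + (A2 t 1 i * A t 1 j + A1 t 1 i * A1 t 1 j)
    - (A1 t 0 i * A1 t 0 j + A t 0 i * A2 t 0 j)
    - (A1 t 1 i * A1 t 1 j + A t 1 i * A2 t 1 j)).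
  by apply: derB; [apply: derB; [apply: derD|]|]; apply: derM;
    first [exact: der_entry|exact: der_entry1].
pose al t : 'M[R]_4 := \matrix_(i, j) (A1 t 0 i * A t 1 j - A1 t 0 j * A t 1 i +
                   (A t 0 i * A1 t 1 j - A t 0 j * A1 t 1 i)).
pose be t : 'M[R]_4 := \matrix_(i, j) (A t 0 i * A2 t 0 j + A t 1 i * A2 t 1 j -
                   (A t 0 j * A2 t 0 i + A t 1 j * A2 t 1 i)).
have al0 t : I t -> [/\ al t 0 1 = 0, al t 0 3 = 0, al t 1 2 = 0 & al t 2 3 = 0].
  by move=> It; apply: constraint_zero; exact: det_constraint.
have be0 t : I t -> [/\ be t 0 1 = 0, be t 0 3 = 0, be t 1 2 = 0 & be t 2 3 = 0].
  by move=> It; apply: constraint_zero; exact: curl_constraint.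
have Kc i j : (forall t, I t -> al t i j = 0) -> forall t, I t -> K i j t = K i j t0.
  move=> h t It; have dK0 : der I (K i j) (fun=> 0).
    apply: (fun H => der_ext H (dK i j)) => s Is; have := h s Is; rewrite !mxE => <-.
    by ring.
  exact: (der0_const oI dK0).
have Lc i j : (forall t, I t -> be t i j = 0) -> forall t, I t -> L i j t = L i j t0.
  move=> h t It; have dL0 : der I (L i j) (fun=> 0).
    apply: (fun H => der_ext H (dL i j)) => s Is; have := h s Is; rewrite !mxE => E.
    rewrite -[RHS]oppr0 -E; ring.
  exact: (der0_const oI dL0).
have alC t i j : al t j i = - al t i j by rewrite !mxE; ring.
have beC t i j : be t j i = - be t i j by rewrite !mxE; ring.
have K01 := @Kc 0 1 (fun t It => let: And4 h _ _ _ := al0 t It in h).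
have K03 := @Kc 0 3 (fun t It => let: And4 _ h _ _ := al0 t It in h).
have K23 := @Kc 2 3 (fun t It => let: And4 _ _ _ h := al0 t It in h).
have K21 : forall t, I t -> K 2 1 t = K 2 1 t0.
  by apply: Kc => t It; rewrite alC; have [_ _ -> _] := al0 t It; rewrite oppr0.
have L01 := @Lc 0 1 (fun t It => let: And4 h _ _ _ := be0 t It in h).
have L03 := @Lc 0 3 (fun t It => let: And4 _ h _ _ := be0 t It in h).
have L23 := @Lc 2 3 (fun t It => let: And4 _ _ _ h := be0 t It in h).
have L21 : forall t, I t -> L 2 1 t = L 2 1 t0.
  by apply: Lc => t It; rewrite beC; have [_ _ -> _] := be0 t It; rewrite oppr0.
have De0 : K 0 1 t0 * K 2 3 t0 - K 0 3 t0 * K 2 1 t0 != 0.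
  apply/negP => /eqP/subr0_eq dK0.
  (* Stated for arbitrary indices, so that any nonzero entry of the singular matrix [K] can play the
     part of the pivot [kpq]. *)
  have sing i j k l : (forall t, I t -> K i j t = K i j t0) ->
      (forall t, I t -> K i l t = K i l t0) -> (forall t, I t -> K k j t = K k j t0) ->
      (forall t, I t -> K k l t = K k l t0) -> (forall t, I t -> L i j t = L i j t0) ->
      (forall t, I t -> L i l t = L i l t0) ->
      K i j t0 * K k l t0 = K i l t0 * K k j t0 -> K i j t0 != 0 ->
      (exists a, forall t, I t -> A t 0 k = a * A t 0 i /\ A t 1 k = a * A t 1 i) \/
      (exists a b, forall t, I t -> A t 0 l = a * A t 0 j + b * A t 0 i /\
                                A t 1 l = a * A t 1 j + b * A t 1 i).
    move=> h1 h2 h3 h4 h5 h6 h7 h8.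
    exact: (singular_dependent oI (der_entry 0 i) (der_entry 1 i) (der_entry 0 j)
      (der_entry 1 j) (der_entry 0 k) (der_entry 1 k) (der_entry 0 l) (der_entry 1 l)
      h1 h2 h3 h4 h5 h6 h8 h7).
  have one' : (-1 : R) <> 0 by move/eqP; rewrite oppr_eq0 oner_eq0.
  have [k01|k01] := eqVneq (K 0 1 t0) 0; last first.
    have [[a h]|[a [b h]]] := sing 0 1 2 3 K01 K03 K21 K23 L01 L03 dK0 k01.
      have [] := @indep_columns a 0 (-1) 0; last by [].
      by move=> t /h[-> ->]; split; ring.
    have [] := @indep_columns b a 0 (-1); last by [].
    by move=> t /h[-> ->]; split; ring.
  have [k03|k03] := eqVneq (K 0 3 t0) 0; last first.
    have [[a h]|[a [b h]]] := sing 0 3 2 1 K03 K01 K23 K21 L03 L01 (esym dK0) k03.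
      have [] := @indep_columns a 0 (-1) 0; last by [].
      by move=> t /h[-> ->]; split; ring.
    have [] := @indep_columns b (-1) 0 a; last by [].
    by move=> t /h[-> ->]; split; ring.
  have [k21|k21] := eqVneq (K 2 1 t0) 0; last first.
    have [|[a h]|[a [b h]]] := sing 2 1 0 3 K21 K23 K01 K03 L21 L23 _ k21.
    - by rewrite [LHS]mulrC -dK0 mulrC.
    - have [] := @indep_columns (-1) 0 a 0; last by [].
      by move=> t /h[-> ->]; split; ring.
    have [] := @indep_columns 0 a b (-1); last by [].
    by move=> t /h[-> ->]; split; ring.
  have [k23|k23] := eqVneq (K 2 3 t0) 0; last first.
    have [|[a h]|[a [b h]]] := sing 2 3 0 1 K23 K21 K03 K01 L23 L21 _ k23.
    - by rewrite [LHS]mulrC dK0 mulrC.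
    - have [] := @indep_columns (-1) 0 a 0; last by [].
      by move=> t /h[-> ->]; split; ring.
    have [] := @indep_columns 0 (-1) b a; last by [].
    by move=> t /h[-> ->]; split; ring.
  (* If all four entries of [K] vanish, every term of the Cauchy-Binet expansion has a zero factor,
     either an entry of [K] or one of the minors (0, 2) and (1, 3) of [v]. *)
  have [z0 Dz0] : D !=set0 by case: dD.
  have /eqP := P0 Dz0 It0; apply.
  have dv : differentiable v z0 by have /CkS[dv _] := vC 1; exact: dv.
  rewrite (jac_mulmx (A t0) dv : jac ((flow A v)^~ t0) z0 = _).
  have := minor02 Dz0; have := minor13 Dz0; move: k01 k03 k21 k23; rewrite /K /minor det2.
  move: (jac v z0) (A t0) => N B; rewrite !mxE !sum4 => k01 k03 k21 k23 m13 m02.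
  transitivity (
    (B 0 0 * B 1 1 - B 1 0 * B 0 1) * (N 0 0 * N 1 1 - N 1 0 * N 0 1) +
    (B 0 0 * B 1 2 - B 1 0 * B 0 2) * (N 0 0 * N 2 1 - N 2 0 * N 0 1) +
    (B 0 0 * B 1 3 - B 1 0 * B 0 3) * (N 0 0 * N 3 1 - N 3 0 * N 0 1) -
    (B 0 2 * B 1 1 - B 1 2 * B 0 1) * (N 1 0 * N 2 1 - N 2 0 * N 1 1) +
    (B 0 1 * B 1 3 - B 1 1 * B 0 3) * (N 1 0 * N 3 1 - N 3 0 * N 1 1) +
    (B 0 2 * B 1 3 - B 1 2 * B 0 3) * (N 2 0 * N 3 1 - N 3 0 * N 2 1)); first by ring.
  by rewrite k01 k03 k21 k23 m13 m02; ring.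
have deg := degenerate oI (der_entry 0 0) (der_entry 1 0) (der_entry 0 1)
  (der_entry 1 1) (der_entry 0 2) (der_entry 1 2) (der_entry 0 3) (der_entry 1 3)
  K01 K03 K21 K23 L01 L03 De0.
have nf := normal_form oI (der_entry 0 0) (der_entry 1 0) (der_entry 0 1)
  (der_entry 1 1) (der_entry 0 2) (der_entry 1 2) (der_entry 0 3) (der_entry 1 3)
  K01 K03 K21 K23 L01 L03 L21 L23 De0.
apply: nf; apply/negP => /eqP /deg[a [b h]].
have [] := @indep_columns (-1) a 0 b.
  by move=> t /h[-> ->]; split; ring.
by move=> /eqP; rewrite oppr_eq0 oner_eq0.
Qed.


Lemma det_rotation (a : R) : \det (M a) = 1.
Proof. by rewrite det2 !mxE /= -(cos2Dsin2 a); ring. Qed.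

(** Cauchy-Binet: apart from the pairs (0, 2) and (1, 3), only the pairs (0, 1) and (2, 3) of
    columns of [Ac] have nonzero determinants, namely 1 and -1. *)
Lemma det_Ac_mulmx (c t : R) (J : 'M[R]_(4, 2)) :
  minor J 0 2 = 0 -> minor J 1 3 = 0 ->
  \det (Ac c t *m J) = minor J 0 1 - minor J 2 3.
Proof.
have ee : expR (c * t) * expR (- (c * t)) = 1 by rewrite -expRD subrr expR0.
rewrite det2 !mxE !sum4 !mxE /= /minor => h1 h2.
move: ee; move: (expR (c * t)) (expR (- (c * t))) => e e' ee.
transitivity ((e * e') * (J 0 0 * J 1 1 - J 1 0 * J 0 1) +
  e * e * (J 0 0 * J 2 1 - J 2 0 * J 0 1) - e' * e' * (J 1 0 * J 3 1 - J 3 0 * J 1 1)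
  - (e * e') * (J 2 0 * J 3 1 - J 3 0 * J 2 1)); first by ring.
by rewrite h1 h2 ee; ring.
Qed.

(* [(w_1, w_2, w_3, w_4)] becomes [(w_3, w_4, w_1, w_2)]. *)
Definition swap_rows : 'M[R]_4 := \matrix_(i < 4, j < 4)
  nth 0 (nth [::] [:: [:: 0; 0; 1; 0]; [:: 0; 0; 0; 1];
                      [:: 1; 0; 0; 0]; [:: 0; 1; 0; 0]] i) j.

(** Permuting the columns of [Ac] by [swap_rows] exchanges its two rows, and [Mhat (a + pi / 2)] is
    [M a] followed on the right by the same exchange. *)
Lemma reflection_swap (c t a : R) :
  Mhat (a + pi / 2) *m (Ac c t *m swap_rows) = M a *m Ac c t.
Proof.
apply/matrixP => i j; rewrite !mxE !sum2 !mxE !sum4 !mxE /= cosDpihalf sinDpihalf.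
by elim/ord2P: i; elim/ord4P: j => /=; ring.
Qed.

Lemma minor_swap (J : 'M[R]_(4, 2)) :
  [/\ minor (swap_rows *m J) 0 1 = minor J 2 3,
      minor (swap_rows *m J) 2 3 = minor J 0 1,
      minor (swap_rows *m J) 0 2 = - minor J 0 2 &
      minor (swap_rows *m J) 1 3 = - minor J 1 3].
Proof. by rewrite /minor !mxE !sum4 !mxE /=; split; ring. Qed.

Lemma general_solution z0 : D z0 ->
  exists (U V : set 'cV[R]_2) (psi : 'cV[R]_2 -> 'cV[R]_2)
      (c c0 c1 : R) (J1 J2 : set R) (f1 f2 : R -> R) (S : R -> 'M[R]_2),
      [/\ diffeomorphism U V psi /\ (V z0 /\ V `<=` D),
          [/\ open_interval J1, open_interval J2,
              smooth_on J1 f1 & smooth_on J2 f2],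
          forall z, U z -> [/\ J1 (z 0 0), J2 (z 1 0) &
                               1 - derive1 f1 (z 0 0) * derive1 f2 (z 1 0) != 0],
          (forall t, S t = M (c1 * t + c0)) \/
          (forall t, S t = Mhat (c1 * t + c0)) &
          forall z t, U z -> I t ->
            flow A v (psi z) t = S t *m flow (Ac c) (graph_vec f1 f2) z t].
Proof.
move=> Dz0; have [c [c0 [c1 [b00 [b02 [b22 [b31 [b11 [b33 [b13 nf]]]]]]]]]] := flow_normal_form.
(* The coefficients of [flow_normal_form] arranged so that the time dependence is confined to [M]
   and [Ac]. *)
pose B : 'M[R]_4 := \matrix_(i < 4, j < 4)
  nth 0 (nth [::] [:: [:: b00; 0; b02; 0]; [:: 0; b11; 0; b13];
                      [:: 0; 0; b22; 0]; [:: 0; b31; 0; b33]] i) j.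
have AE t : I t -> A t = M (c1 * t + c0) *m (Ac c t *m B).
  move=> It; have [[h1 h2] [h3 h4] [h5 h6] [h7 h8]] := nf t It.
  apply/matrixP => i j; rewrite !mxE !sum2 !mxE !sum4 !mxE /=.
  elim/ord2P: i; elim/ord4P: j => /=;
    rewrite ?h1 ?h2 ?h3 ?h4 ?h5 ?h6 ?h7 ?h8; ring.
pose w z := B *m v z.
have wC : smooth_on D w by move=> k; apply: Ck_mulmx; [exact: oD|exact: Ck_cst|exact: vC].
have dv z : D z -> differentiable v z by have /CkS[h _] := vC 1; exact: h.
have dw z : D z -> differentiable w z by have /CkS[h _] := wC 1; exact: h.
have jw z : D z -> jac w z = B *m jac v z by move=> Dz; rewrite jac_mulmx //; exact: dv.
(* [B] does not mix the indices 0, 2 with 1, 3, so it only rescales these two minors. *)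
have m02 z : D z -> minor (jac w z) 0 2 = 0.
  move=> Dz; transitivity (b00 * b22 * minor (jac v z) 0 2); last by rewrite minor02 ?mulr0.
  by rewrite jw // /minor; move: (jac v z) => J; rewrite !mxE !sum4 !mxE /=; ring.
have m13 z : D z -> minor (jac w z) 1 3 = 0.
  move=> Dz; transitivity ((b11 * b33 - b13 * b31) * minor (jac v z) 1 3).
    by rewrite jw // /minor; move: (jac v z) => J; rewrite !mxE !sum4 !mxE /=; ring.
  by rewrite minor13 ?mulr0.
have mne z : D z -> minor (jac w z) 0 1 - minor (jac w z) 2 3 != 0.
  move=> Dz; have [t0 It0] : I !=set0 by case: oI.
  have := P0 Dz It0.
  rewrite (jac_mulmx (A t0) (dv z Dz) : jac ((flow A v)^~ t0) z = _) AE //.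
  rewrite -!mulmxA -jw // det_mulmx det_rotation mul1r det_Ac_mulmx //.
    exact: m02.
  exact: m13.
have flowE z t : I t -> flow A v z t = M (c1 * t + c0) *m (Ac c t *m w z).
  by move=> It; rewrite /flow AE // -!mulmxA.
have [m01|m01] := eqVneq (minor (jac w z0) 0 1) 0; last first.
  have [U [V [psi [J1 [J2 [f1 [f2 [h1 h2 h3 h4]]]]]]]] := local_graph oD wC m02 m13 mne Dz0 m01.
  exists U, V, psi, c, c0, c1, J1, J2, f1, f2, (fun t => M (c1 * t + c0)).
  split => //; first by left.
  by move=> z t Uz It; rewrite flowE // h4.
(* Here the minor (0, 1) vanishes at [z0], so by [mne] the minor (2, 3) does not, and the last two
   components serve as coordinates. *)
pose w' z := swap_rows *m w z.
have w'C : smooth_on D w' by move=> k; apply: Ck_mulmx; [exact: oD|exact: Ck_cst|exact: wC].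
have jw' z : D z -> jac w' z = swap_rows *m jac w z.
  by move=> Dz; rewrite jac_mulmx //; exact: dw.
have [||||U [V [psi [J1 [J2 [f1 [f2 [h1 h2 h3 h4]]]]]]]] :=
    @local_graph R D w' oD w'C _ _ _ z0 Dz0.
- by move=> z Dz; rewrite jw' //; have [_ _ -> _] := minor_swap (jac w z); rewrite m02 ?oppr0.
- by move=> z Dz; rewrite jw' //; have [_ _ _ ->] := minor_swap (jac w z); rewrite m13 ?oppr0.
- move=> z Dz; rewrite jw' //; have [-> -> _ _] := minor_swap (jac w z).
  by rewrite -oppr_eq0 opprB mne.
- rewrite jw' //; have [-> _ _ _] := minor_swap (jac w z0).
  by have := mne z0 Dz0; rewrite m01 sub0r oppr_eq0.
exists U, V, psi, c, (c0 + pi / 2), c1, J1, J2, f1, f2, (fun t => Mhat (c1 * t + (c0 + pi / 2))).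
split => //; first by right.
move=> z t Uz It; rewrite flowE // /flow -h4 // /w' addrA.
by rewrite !mulmxA -reflection_swap !mulmxA.
Qed.

End Necessary.

Theorem theorem5p3 (R : realType) :
  (forall (c : R) (D : set 'cV[R]_2) (J1 J2 : set R) (f1 f2 : R -> R),
    domain D -> open J1 -> open J2 -> smooth_on J1 f1 -> smooth_on J2 f2 ->
    (forall z, D z -> J1 (z 0 0) /\ J2 (z 1 0)) ->
    (forall z, D z -> 1 - derive1 f1 (z 0 0) * derive1 f2 (z 1 0) != 0) ->
    let phi := flow (Ac c) (graph_vec f1 f2) in
    [/\ gives_euler_solution D setT phi,
        forall z t, D z ->
          \det (jac (phi^~ t) z) = 1 - derive1 f1 (z 0 0) * derive1 f2 (z 1 0) &
        forall W J u, local_velocity D setT phi W J u ->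
        forall z t, W z -> J t ->
          vorticity (u^~ t) (phi z t) =
            2 * c * (derive1 f1 (z 0 0) + derive1 f2 (z 1 0)) /
              (1 - derive1 f1 (z 0 0) * derive1 f2 (z 1 0))])
  /\
  (forall (D : set 'cV[R]_2) (I : set R) (A : R -> 'M[R]_(2, 4))
      (v : 'cV[R]_2 -> 'cV[R]_4),
    domain D -> open_interval I -> smooth_on I A -> smooth_on D v ->
    (forall z t, D z -> I t -> \det (jac ((flow A v)^~ t) z) != 0) ->
    gives_euler_solution D I (flow A v) ->
    constraints_exactly_g13_g24 D v ->
    columns_independent I A ->
    forall z0, D z0 ->
    exists (U V : set 'cV[R]_2) (psi : 'cV[R]_2 -> 'cV[R]_2)
      (c c0 c1 : R) (J1 J2 : set R) (f1 f2 : R -> R) (S : R -> 'M[R]_2),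
      [/\ diffeomorphism U V psi /\ (V z0 /\ V `<=` D),
          [/\ open_interval J1, open_interval J2,
              smooth_on J1 f1 & smooth_on J2 f2],
          forall z, U z -> [/\ J1 (z 0 0), J2 (z 1 0) &
                               1 - derive1 f1 (z 0 0) * derive1 f2 (z 1 0) != 0],
          (forall t, S t = M (c1 * t + c0)) \/
          (forall t, S t = Mhat (c1 * t + c0)) &
          forall z t, U z -> I t ->
            flow A v (psi z) t = S t *m flow (Ac c) (graph_vec f1 f2) z t]).
Proof.
split.
  move=> c D J1 J2 f1 f2 [_ oD _] oJ1 oJ2 C1 C2 DJ P0 phi; split.
  - exact: (@explicit_gives_euler R c D J1 J2 f1 f2 oD C1 C2 DJ P0).
  - move=> z t Dz; rewrite -(det_jac_graph c C1 C2 DJ t Dz); congr (\det _).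
    apply: jac_mulmx; have /CkS[dv _] := smooth_graph_vec oD C1 C2 DJ 1.
    exact: dv.
  - by move=> W J u uP z t Wz Jt; exact: (explicit_vorticity oD C1 C2 DJ P0 uP).
move=> D I A v dD oI AC vC P0 euler cons indep z0 Dz0.
exact: (general_solution dD oI AC vC P0 euler cons indep Dz0).
Qed.
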